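(* Let $N>1$ be an integer, let $1<p<N$ and $$p-1<\gamma\le\frac{N(p-1)}{N-1},$$ and let $\nu>0$, $c_H>0$. Let $\mathcal{A}:\mathbb{R}^N\times\mathbb{R}\times\mathbb{R}^N\to\mathbb{R}^N$ be a Carathéodory function with $|\mathcal{A}(x,s,\xi)|\le\nu|\xi|^{p-1}$ for every $(s,\xi)\in\mathbb{R}\times\mathbb{R}^N$ and a.e. $x\in\mathbb{R}^N$, and let $\mathcal{B}_2(x,s,\xi)\in\mathbb{R}$ satisfy $\mathcal{B}_2(x,s,\xi)\ge c_H|\xi|^\gamma$. Then: (i) any distributional solution of the inequality $$-\mathrm{div}(\mathcal{A}(x,u,\nabla u))\ge\mathcal{B}_2(x,u,\nabla u)\quad\text{in }\mathbb{R}^N$$ is a.e. constant in $\mathbb{R}^N$; (ii) any distributional solution of the equation $$-\mathrm{div}(\mathcal{A}(x,u,\nabla u))+c_H|\nabla u|^\gamma=0\quad\text{in }\mathbb{R}^N$$ is a.e. constant in $\mathbb{R}^N$.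
   Context: A Carathéodory function is measurable in $x$ and continuous in $(s,\xi)$. Distributional solution of the inequality $-\mathrm{div}(\mathcal{A}(x,u,\nabla u))\ge\mathcal{B}(x,u,\nabla u)$ in $\mathbb{R}^N$: $u\in W^{1,p}_{\mathrm{loc}}(\mathbb{R}^N)$ with $\mathcal{A}(\cdot,u,\nabla u)\in L^{p'}_{\mathrm{loc}}(\mathbb{R}^N)$, $p'=\frac{p}{p-1}$, $\mathcal{B}(\cdot,u,\nabla u)\in L^1_{\mathrm{loc}}(\mathbb{R}^N)$, and $$\int_{\mathbb{R}^N}\mathcal{A}(x,u,\nabla u)\cdot\nabla\varphi\,dx\ge\int_{\mathbb{R}^N}\mathcal{B}(x,u,\nabla u)\varphi\,dx\qquad\text{for all }\varphi\in C^1_0(\mathbb{R}^N),\ \varphi\ge0.$$ A distributional solution of the equation $-\mathrm{div}(\mathcal{A}(x,u,\nabla u))+c_H|\nabla u|^\gamma=0$ is defined with the same regularity (with $|\nabla u|^\gamma\in L^1_{\mathrm{loc}}$) and with $\int\mathcal{A}(x,u,\nabla u)\cdot\nabla\varphi\,dx=-\int c_H|\nabla u|^\gamma\varphi\,dx$ for all $\varphi\in C^1_0(\mathbb{R}^N)$. *)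

(* Defs.v *)
From HB Require Import structures.
From mathcomp Require Import all_boot all_order all_algebra.
From mathcomp Require Import all_classical all_reals all_analysis.

Set Implicit Arguments.
Unset Strict Implicit.
Unset Printing Implicit Defensive.

Import Order.TTheory GRing.Theory Num.Theory.
Import numFieldNormedType.Exports.

Local Open Scope classical_set_scope.
Local Open Scope ring_scope.

(* Product sigma-algebra on 'rV[R]_n, generated by the n coordinate maps, as
   the library does for n.-tuple. *)

Definition rV_display : measure_display -> measure_display.
Proof. exact. Qed.

Section measurable_rV.
Variables (R : realType) (n : nat).

Definition rV_coord (i : 'I_n) (x : 'rV[R]_n) : measurableTypeR R := x ord0 i.

Let rV_set0 : g_sigma_preimage rV_coord set0.
Proof. exact: sigma_algebra0. Qed.

Let rV_setC A : g_sigma_preimage rV_coord A ->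
  g_sigma_preimage rV_coord (~` A).
Proof. exact: sigma_algebraC. Qed.

Let rV_bigcup (F : (set 'rV[R]_n)^nat) :
  (forall i, g_sigma_preimage rV_coord (F i)) ->
  g_sigma_preimage rV_coord (\bigcup_i (F i)).
Proof. exact: sigma_algebra_bigcup. Qed.

HB.instance Definition _ := @isMeasurable.Build (rV_display default_measure_display)
  'rV[R]_n (g_sigma_preimage rV_coord) rV_set0 rV_setC rV_bigcup.

End measurable_rV.

Section measurable_fun_rV.
Context (R : realType) (n : nat) d (T : measurableType d).

Lemma measurable_rV_coord (i : 'I_n) :
  measurable_fun [set: 'rV[R]_n] (@rV_coord R n i).
Proof.
move=> _ Y mY; rewrite setTI; apply: sub_sigma_algebra => /=.
rewrite -bigcup_seq/=; exists i => /=; first by rewrite mem_index_enum.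
by exists Y => //; rewrite setTI.
Qed.

Lemma measurable_fun_rVP (f : T -> 'rV[R]_n) :
  measurable_fun [set: T] f <->
  forall i, measurable_fun [set: T] (fun x => f x ord0 i).
Proof.
split=> [mf i|mf].
  exact: (measurableT_comp (measurable_rV_coord i) mf).
have fS : g_sigma_preimage (fun i => @rV_coord R n i \o f) `<=` measurable.
  apply: smallest_sub; first exact: sigma_algebra_measurable.
  rewrite -bigcup_seq => A [i _] [B mB <-].
  exact: mf.
move: fS; rewrite g_sigma_preimage_comp => fS.
by move=> _ A mA; apply: fS; exists A.
Qed.

End measurable_fun_rV.

(* Lebesgue measure on the product sigma-algebra of 'rV[R]_n, obtained by
   iterating the binary product; lebesgue_rV_box gives its value on boxes. *)

Section lebesgue_rV.
Variable R : realType.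

Definition rV_cons n (z : measurableTypeR R * 'rV[R]_n) : 'rV[R]_n.+1 :=
  row_mx (z.1 : R)%:M z.2.

Lemma rV_cons0 n z : @rV_cons n z ord0 ord0 = z.1.
Proof.
rewrite /rV_cons mxE; case: splitP => [j _|k //].
by rewrite (ord1 j) mxE eqxx mulr1n.
Qed.

Lemma rV_consS n z (i : 'I_n) : @rV_cons n z ord0 (lift ord0 i) = z.2 ord0 i.
Proof.
rewrite /rV_cons mxE; case: splitP => [j|k].
  by rewrite (ord1 j) /= /bump leq0n.
rewrite /= /bump leq0n !add1n => -[ik].
by congr (z.2 _ _); exact/val_inj.
Qed.

Lemma measurable_rV_cons n : measurable_fun setT (@rV_cons n).
Proof.
apply/measurable_fun_rVP => i; case: (unliftP ord0 i) => [j|] ->.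
  under [X in measurable_fun _ X]funext do rewrite rV_consS.
  exact: (measurableT_comp (measurable_rV_coord j) measurable_snd).
under [X in measurable_fun _ X]funext do rewrite rV_cons0.
exact: measurable_fst.
Qed.

Definition rV_uncons n (x : 'rV[R]_n.+1) : measurableTypeR R * 'rV[R]_n :=
  (x ord0 ord0, \row_i x ord0 (lift ord0 i)).

Lemma rV_consK n : cancel (@rV_cons n) (@rV_uncons n).
Proof.
move=> z; rewrite /rV_uncons rV_cons0 [RHS]surjective_pairing; congr pair.
by apply/rowP => i; rewrite mxE rV_consS.
Qed.

Lemma measurable_rV_uncons n : measurable_fun setT (@rV_uncons n).
Proof.
apply/measurable_fun_pairP; split; first exact: measurable_rV_coord.
apply/measurable_fun_rVP => i.
under [X in measurable_fun _ X]funext do rewrite /= mxE.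
exact: measurable_rV_coord.
Qed.

Section step.
Variables (n : nat) (m : {sigma_finite_measure set 'rV[R]_n -> \bar R}).

Definition lebesgue_rV_step : set 'rV[R]_n.+1 -> \bar R :=
  pushforward (lebesgue_measure \x m)%E (@rV_cons n).


Let step0 : lebesgue_rV_step set0 = 0%E.
Proof. by have mf := @measurable_rV_cons n; exact: measure0. Qed.

Let step_ge0 A : (0 <= lebesgue_rV_step A)%E.
Proof. by have mf := @measurable_rV_cons n; exact: measure_ge0. Qed.

Let step_sigma_additive : semi_sigma_additive lebesgue_rV_step.
Proof.
by have mf := @measurable_rV_cons n; exact: measure_semi_sigma_additive.
Qed.

HB.instance Definition _ := isMeasure.Build _ _ _ lebesgue_rV_step
  step0 step_ge0 step_sigma_additive.

Let step_sigma_finite : sigma_finite setT lebesgue_rV_step.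
Proof.
have /sigma_finiteP[F [TF ndF Foo]] := sigma_finiteT (@lebesgue_measure R).
have /sigma_finiteP[G [TG ndG Goo]] := sigma_finiteT m.
exists (fun k => @rV_uncons n @^-1` (F k `*` G k)).
  apply/seteqP; split=> // x _.
  have [k _ Fk] : (\bigcup_i F i) (rV_uncons x).1 by rewrite -TF.
  have [l _ Gl] : (\bigcup_i G i) (rV_uncons x).2 by rewrite -TG.
  exists (maxn k l) => //; split => /=.
    by move: Fk; exact/subsetPset/ndF/leq_maxl.
  by move: Gl; exact/subsetPset/ndG/leq_maxr.
move=> k; have [mF Fk] := Foo k; have [mG Gk] := Goo k; split.
  rewrite -[X in measurable X]setTI; apply: measurable_rV_uncons => //.
  exact: measurableX.
rewrite /lebesgue_rV_step /pushforward -comp_preimage.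
rewrite (_ : _ \o _ = id) ?preimage_id; last first.
  by apply/funext => z /=; exact: rV_consK.
by rewrite product_measure1E// lte_mul_pinfty// ge0_fin_numE.
Qed.

HB.instance Definition _ := Measure_isSigmaFinite.Build _ _ _ lebesgue_rV_step
  step_sigma_finite.

Lemma lebesgue_rV_stepE (A : set R) (B : set 'rV[R]_n) :
  measurable A -> measurable B ->
  lebesgue_rV_step [set x : 'rV[R]_n.+1 | A (x ord0 ord0) /\ B (rV_uncons x).2] =
  (lebesgue_measure A * m B)%E.
Proof.
move=> mA mB; rewrite -product_measure1E//; congr (product_measure1 _ _ _).
by apply/funext => z; rewrite /preimage /setX /mkset rV_cons0 rV_consK.
Qed.

End step.

Fixpoint lebesgue_rV n : {sigma_finite_measure set 'rV[R]_n -> \bar R} :=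
  match n with
  | 0 => dirac (0 : 'rV[R]_0)
  | n'.+1 => lebesgue_rV_step (lebesgue_rV n')
  end.

Lemma lebesgue_rV_box n (A : 'I_n -> set R) : (forall i, measurable (A i)) ->
  measurable [set x : 'rV[R]_n | forall i, A i (x ord0 i)] /\
  lebesgue_rV n [set x : 'rV[R]_n | forall i, A i (x ord0 i)] =
    (\prod_(i < n) lebesgue_measure (A i))%E.
Proof.
elim: n A => [|n IH] A mA.
  have -> : [set x : 'rV[R]_0 | forall i, A i (x ord0 i)] = setT.
    by apply/seteqP; split=> // x _ [].
  by split; [exact: measurableT|rewrite big_ord0 /= diracT].
have [mB Bprod] := IH (fun i => A (lift ord0 i)) (fun i => mA _).
set B := [set _ | _] in mB Bprod.
have -> : [set x : 'rV[R]_n.+1 | forall i, A i (x ord0 i)] =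
    [set x : 'rV[R]_n.+1 | A ord0 (x ord0 ord0) /\ B (rV_uncons x).2].
  apply/seteqP; split=> x /=.
    by move=> Ax; split=> [|i]; [exact: Ax|rewrite mxE; exact: Ax].
  move=> [A0 AS] i; case: (unliftP ord0 i) => [j|] -> //.
  by have := AS j; rewrite mxE.
split; last by rewrite big_ord_recl -Bprod; exact: lebesgue_rV_stepE.
rewrite (_ : [set _ | _] = @rV_uncons n @^-1` (A ord0 `*` B)) //.
rewrite -[X in measurable X]setTI; apply: measurable_rV_uncons => //.
exact: (@measurableX _ _ (measurableTypeR R) _ _ _ (mA ord0) mB).
Qed.

End lebesgue_rV.

(* lebesgue_type R n is 'rV[R]_n with the sigma-algebra of Lebesgue measurable
   sets, and lebesgue_Rn the complete Lebesgue measure on it, constructed from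
   lebesgue_rV as completed_lebesgue_measure is in dimension one. *)

Section lebesgue_Rn.
Variables (R : realType) (n : nat).

Definition lebesgue_type : Type :=
  caratheodory_type ((@lebesgue_rV R n)^*)%mu.

HB.instance Definition _ := Measurable.on lebesgue_type.

Definition lebesgue_Rn : set lebesgue_type -> \bar R :=
  @completed_measure_extension _ _ _ (@lebesgue_rV R n).

HB.instance Definition _ := Measure.on lebesgue_Rn.

Let sigma_finite_lebesgue_Rn : sigma_finite setT lebesgue_Rn.
Proof. exact/completed_measure_extension_sigma_finite/sigma_finiteT. Qed.

HB.instance Definition _ := @Measure_isSigmaFinite.Build _ _ _ lebesgue_Rn
  sigma_finite_lebesgue_Rn.

Lemma lebesgue_Rn_is_complete : measure_is_complete lebesgue_Rn.
Proof. exact: measure_is_complete_caratheodory. Qed.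

Lemma lebesgue_RnE (A : set 'rV[R]_n) : measurable A ->
  measurable (A : set lebesgue_type) /\ lebesgue_Rn A = lebesgue_rV R n A.
Proof.
move=> mA; split; first exact: caratheodory_measurable_mu_ext.
exact: measurable_mu_extE.
Qed.

End lebesgue_Rn.

Section distributional_solutions.
Variables (R : realType) (N : nat).
Local Notation V := 'rV[R]_N.
Local Notation mu := (@lebesgue_Rn R N).

Implicit Types (u f phi : V -> R) (G F : V -> V).

Definition dotp (v w : V) : R := \sum_(i < N) v ord0 i * w ord0 i.

(* The library norm on 'rV[R]_N is the sup norm. *)
Definition enorm (v : V) : R := Num.sqrt (dotp v v).

Definition partial (i : 'I_N) phi (x : V) : R := 'D_(delta_mx ord0 i) phi x.

Definition grad phi (x : V) : V := \row_i partial i phi x.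

(* C^1_0(R^N): continuously differentiable with compact support *)
Definition C1_0 phi : Prop :=
  [/\ forall x, differentiable phi x,
      forall i, continuous (partial i phi)
    & compact (closure [set x | phi x != 0])].

(* L^q_loc(R^N), for 0 < q < +oo *)
Definition Lloc (q : R) f : Prop :=
  measurable_fun [set: lebesgue_type R N] f /\
  forall K : set V, compact K -> finite_norm mu q%:E (f \_ K).

Definition Lloc_vec (q : R) F : Prop :=
  forall i : 'I_N, Lloc q (fun x => F x ord0 i).

(* All the integrands below are integrable under the local integrability
   assumptions they are used with, so Rintegral never takes a junk value. *)
Definition weak_gradient u G : Prop :=
  forall (i : 'I_N) phi, C1_0 phi ->
    \int[mu]_x (u x * partial i phi x) = - \int[mu]_x (G x ord0 i * phi x).

(* u is in W^{1,p}_loc(R^N) and G is (a representative of) its gradient *)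
Definition W1p_loc (p : R) u G : Prop :=
  [/\ Lloc p u, Lloc_vec p G & weak_gradient u G].

Definition caratheodory_fun (A : V -> R -> V -> V) : Prop :=
  (forall s xi, measurable_fun [set: lebesgue_type R N] (fun x => A x s xi)) /\
  {ae mu, forall x, continuous (fun z : R * V => A x z.1 z.2)}.

(* -div (A(x,u,grad u)) >= B(x,u,grad u) in R^N *)
Definition dist_supersolution (p : R) (A : V -> R -> V -> V)
    (B : V -> R -> V -> R) u : Prop :=
  exists G,
    [/\ W1p_loc p u G,
        Lloc_vec (p / (p - 1)) (fun x => A x (u x) (G x)),
        Lloc 1 (fun x => B x (u x) (G x))
      & forall phi, C1_0 phi -> (forall x, 0 <= phi x) ->
          \int[mu]_x dotp (A x (u x) (G x)) (grad phi x) >=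
          \int[mu]_x (B x (u x) (G x) * phi x)].

(* -div (A(x,u,grad u)) + cH |grad u|^gamma = 0 in R^N *)
Definition dist_solution (p gamma cH : R) (A : V -> R -> V -> V) u : Prop :=
  exists G,
    [/\ W1p_loc p u G,
        Lloc_vec (p / (p - 1)) (fun x => A x (u x) (G x)),
        Lloc 1 (fun x => enorm (G x) `^ gamma)
      & forall phi, C1_0 phi ->
          \int[mu]_x dotp (A x (u x) (G x)) (grad phi x) =
          - \int[mu]_x (cH * enorm (G x) `^ gamma * phi x)].

Definition ae_constant u : Prop := exists c : R, {ae mu, forall x, u x = c}.

End distributional_solutions.

(* Main.v *)
Require Import Defs.
From HB Require Import structures.
From mathcomp Require Import all_boot all_order all_algebra.
From mathcomp Require Import all_classical all_reals all_analysis.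
From mathcomp Require Import measurable_realfun ring lra.

Set Implicit Arguments.
Unset Strict Implicit.
Unset Printing Implicit Defensive.

Import Order.TTheory GRing.Theory Num.Theory.
Import numFieldNormedType.Exports.

Local Open Scope classical_set_scope.
Local Open Scope ring_scope.

(** Testing the inequality with a cutoff [phi_n] equal to 1 on the cube
  [[-n, n]^N] and supported in [[-3n, 3n]^N], and using Young's inequality with
  a free parameter [d], gives
    [cH * X <= nu * (d * Y + d^(1 - q) * K)],   [q = gamma / (gamma - p + 1)],
  where [X] is the integral of [|grad u|^gamma * phi_n], [Y] is the part of [X]
  carried by the support of [grad phi_n], and [K] does not depend on [n] because
  [n^(N - q) <= 1], which is the assumption on [gamma].  A small [d] shows that
  [|grad u|^gamma] is integrable on the whole space; then [Y] tends to 0 as [n]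
  goes to infinity, and a large [d] gives [grad u = 0], including when [q = N].

  A function with zero weak gradient is constant because its integral against
  a product of one-variable bumps [b_i(x_i)] depends only on the integrals of
  the [b_i]: the difference of two bumps with the same integral is the
  derivative of a compactly supported function.  Letting the bumps tend to
  indicators of intervals, the averages of [u] on all boxes coincide. *)

(** * A C^1 step function and its primitive *)

Section smooth_step.
Variable R : realType.
Implicit Types t a b h x y : R.

Definition posp t : R := Num.max t 0.

(** The slope between [x] and [z] differs from [l] by at most [C * |z - x|]. A quadratic remainder
    bound reduces the differentiation of a piecewise polynomial to polynomial inequalities checked
    on each piece. *)
Lemma is_derive_quadratic (f : R -> R) x l C :
  (forall y, `|f y - f x - l * (y - x)| <= C * (y - x) ^+ 2) ->
  is_derive x (1 : R) f l.
Proof.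
move=> fC.
have C0 : 0 <= C.
  have := fC (x + 1); rewrite (addrC x 1) addrK expr1n !mulr1.
  exact: le_trans.
apply/is_derive1_caratheodory.
exists (fun z => if z == x then l else (f z - f x) / (z - x)); split => /=.
- move=> z; case: eqVneq => [->|zx]; first by rewrite !subrr mulr0.
  by rewrite divfK// subr_eq0.
- apply/cvgrPdist_le => /= e e0; rewrite eqxx; near=> z.
  case: eqVneq => [_|zx]; first by rewrite subrr normr0 ltW.
  have zx0 : 0 < `|z - x| by rewrite normr_gt0 subr_eq0.
  have -> : l - (f z - f x) / (z - x) = - ((f z - f x - l * (z - x)) / (z - x)).
    by field; rewrite subr_eq0.
  rewrite normrN normrM normfV ler_pdivrMr// (le_trans (fC z))//.
  rewrite -[(z - x) ^+ 2]ger0_norm ?sqr_ge0// normrX expr2 mulrA.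
  apply: ler_wpM2r => //.
  (* [C + 1] rather than [C], since [C] may be zero. *)
  have : `|x - z| <= e / (C + 1).
    near: z; apply: cvgr_dist_le; first exact: cvg_id.
    by rewrite divr_gt0// ltr_wpDl.
  rewrite distrC ler_pdivlMr; last by rewrite ltr_wpDl.
  by apply: le_trans; rewrite mulrC ler_wpM2l// lerDl.
- by rewrite eqxx.
Unshelve. all: by end_near. Qed.

Lemma is_derive_posp2 t :
  is_derive t (1 : R) (fun x => posp x ^+ 2) (2 * posp t).
Proof.
apply: (@is_derive_quadratic _ _ _ 1) => y; rewrite /posp.
rewrite ler_norml; case: (leP y 0) => y0; case: (leP t 0) => t0.
- have := sqr_ge0 (y - t); lra.
- have := mulr_ge0_le0 (ltW t0) y0; have := sqr_ge0 (y - t); nra.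
- have := mulr_ge0_le0 (ltW y0) t0; have := sqr_ge0 (y - t); nra.
- have := sqr_ge0 (y - t); lra.
Qed.

Lemma is_derive_posp3 t :
  is_derive t (1 : R) (fun x => posp x ^+ 3) (3 * posp t ^+ 2).
Proof.
have -> : (fun x => posp x ^+ 3) = (id * (fun x => posp x ^+ 2)).
  apply/funext => x; rewrite /posp -[RHS]/(x * Num.max x 0 ^+ 2).
  by rewrite exprS; case: (leP x 0) => // _; rewrite expr2 !mul0r mulr0.
have D := is_derive_posp2 t; apply: is_derive_eq.
by rewrite /posp /GRing.scale/=; case: (leP t 0) => _; ring.
Qed.

Lemma continuous_posp : continuous posp.
Proof. by move=> t; apply: continuous_max; [exact: cvg_id|exact: cvg_cst]. Qed.

(* Second differences of [t_+^k / k!] for k = 2, 1, 3: [dstep] is the derivative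
   of [step], and [pstep] its primitive vanishing on the negative numbers. *)
Definition step t : R :=
  (posp t ^+ 2 - 2 * posp (t - 1) ^+ 2 + posp (t - 2) ^+ 2) / 2.
Definition dstep t : R := posp t - 2 * posp (t - 1) + posp (t - 2).
Definition pstep t : R :=
  (posp t ^+ 3 - 2 * posp (t - 1) ^+ 3 + posp (t - 2) ^+ 3) / 6.

Lemma posp_ge0E t : 0 <= t -> posp t = t.
Proof. by move=> t0; rewrite /posp max_l. Qed.

Lemma posp_le0E t : t <= 0 -> posp t = 0.
Proof. by move=> t0; rewrite /posp max_r. Qed.

Lemma step_le0 t : t <= 0 -> step t = 0.
Proof. by move=> t0; rewrite /step !posp_le0E; lra. Qed.

Lemma step_ge2 t : 2 <= t -> step t = 1.
Proof. by move=> t0; rewrite /step !posp_ge0E; lra. Qed.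

Lemma dstep_le0 t : t <= 0 -> dstep t = 0.
Proof. by move=> t0; rewrite /dstep !posp_le0E; lra. Qed.

Lemma dstep_ge2 t : 2 <= t -> dstep t = 0.
Proof. by move=> t0; rewrite /dstep !posp_ge0E; lra. Qed.

Lemma pstep_le0 t : t <= 0 -> pstep t = 0.
Proof. by move=> t0; rewrite /pstep !posp_le0E; lra. Qed.

Lemma pstep_ge2 t : 2 <= t -> pstep t = t - 1.
Proof. by move=> t0; rewrite /pstep !posp_ge0E; lra. Qed.

Lemma dstep_itv t : 0 <= dstep t <= 1.
Proof.
rewrite /dstep /posp; case: (leP t 0) => ?; case: (leP (t - 1) 0) => ?;
  case: (leP (t - 2) 0) => ?; lra.
Qed.

Lemma is_derive_comp_affine (g dg : R -> R) (c k t : R) :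
  (forall x, is_derive x (1 : R) g (dg x)) ->
  is_derive t (1 : R) (fun x => g (k * (x - c))) (k * dg (k * (t - c))).
Proof.
move=> H; have Hk := H (k * (t - c)).
have E : is_derive t (1 : R) (fun x => k * (x - c)) k.
  have -> : (fun x => k * (x - c)) = k *: (fun x => x - c) by [].
  by apply: is_derive_eq; rewrite subr0 /GRing.scale/= mulr1.
have := @is_derive1_comp _ g (fun x => k * (x - c)) t _ _ Hk E.
by rewrite mulrC.
Qed.

Lemma is_derive_step t : is_derive t (1 : R) step (dstep t).
Proof.
have D c := @is_derive_comp_affine _ _ c 1 t is_derive_posp2.
have -> : step = (2^-1 *: ((fun x => posp (1 * (x - 0)) ^+ 2)
    - 2 *: (fun x => posp (1 * (x - 1)) ^+ 2)
    + (fun x => posp (1 * (x - 2)) ^+ 2))).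
  apply/funext => x.
  rewrite -[RHS]/(2^-1 * (posp (1 * (x - 0)) ^+ 2
    - 2 * (posp (1 * (x - 1)) ^+ 2) + posp (1 * (x - 2)) ^+ 2)).
  by rewrite !mul1r subr0 /step mulrC.
apply: is_derive_eq.
by rewrite !mul1r subr0 /dstep /GRing.scale/=; field.
Qed.

Lemma is_derive_pstep t : is_derive t (1 : R) pstep (step t).
Proof.
have D c := @is_derive_comp_affine _ _ c 1 t is_derive_posp3.
have -> : pstep = (6^-1 *: ((fun x => posp (1 * (x - 0)) ^+ 3)
    - 2 *: (fun x => posp (1 * (x - 1)) ^+ 3)
    + (fun x => posp (1 * (x - 2)) ^+ 3))).
  apply/funext => x.
  rewrite -[RHS]/(6^-1 * (posp (1 * (x - 0)) ^+ 3
    - 2 * (posp (1 * (x - 1)) ^+ 3) + posp (1 * (x - 2)) ^+ 3)).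
  by rewrite !mul1r subr0 /pstep mulrC.
apply: is_derive_eq.
by rewrite !mul1r subr0 /step /GRing.scale/=; field.
Qed.

Lemma continuous_dstep : continuous dstep.
Proof.
move=> t; rewrite /dstep.
have c k : {for t, continuous (fun x : R => posp (x - k))}.
  apply: (@continuous_comp _ _ _ (fun x => x - k) posp).
    by apply: cvgB; [exact: cvg_id|exact: cvg_cst].
  exact: continuous_posp.
apply: cvgD; last exact: c.
apply: cvgB; first exact: continuous_posp.
by apply: cvgM; [exact: cvg_cst|exact: c].
Qed.

Lemma step_nondecreasing : {homo step : x y / x <= y}.
Proof.
move=> x y xy; rewrite /step /posp.
case: (leP x 0) => ?; case: (leP (x - 1) 0) => ?; case: (leP (x - 2) 0) => ?;
case: (leP y 0) => ?; case: (leP (y - 1) 0) => ?; case: (leP (y - 2) 0) => ?;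
nra.
Qed.
End smooth_step.

(** * Products of one-variable bumps *)

Section bump.
Variable R : realType.
Implicit Types k a b t : R.

(* For every [k > 0], [bump k a b] has integral [b - a]: its primitive [pbump]
   takes the value [b - a] to the right of the support. *)
Definition bump k a b t : R := step (k * (t - a)) - step (k * (t - b)).
Definition dbump k a b t : R :=
  k * (dstep (k * (t - a)) - dstep (k * (t - b))).
Definition pbump k a b t : R :=
  k^-1 * (pstep (k * (t - a)) - pstep (k * (t - b))).

Lemma is_derive_bump k a b t : is_derive t (1 : R) (bump k a b) (dbump k a b t).
Proof.
have D c := @is_derive_comp_affine _ _ _ c k t (@is_derive_step R).
have -> : bump k a b =
  (fun x => step (k * (x - a))) - (fun x => step (k * (x - b))) by [].
by apply: is_derive_eq; rewrite /dbump [RHS]mulrBr.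
Qed.

Lemma is_derive_pbump k a b t : k != 0 ->
  is_derive t (1 : R) (pbump k a b) (bump k a b t).
Proof.
move=> k0.
have D c := @is_derive_comp_affine _ _ _ c k t (@is_derive_pstep R).
have -> : pbump k a b = k^-1 *: ((fun x => pstep (k * (x - a)))
  - (fun x => pstep (k * (x - b)))) by [].
apply: is_derive_eq.
rewrite /bump /GRing.scale/= -mulrBr. by rewrite mulKf.
Qed.

Lemma continuous_dbump k a b : continuous (dbump k a b).
Proof.
move=> t; rewrite /dbump.
have c d : {for t, continuous (fun x : R => dstep (k * (x - d)))}.
  apply: (@continuous_comp _ _ _ (fun x => k * (x - d)) (@dstep R)).
    apply: cvgM; first exact: cvg_cst.
    by apply: cvgB; [exact: cvg_id|exact: cvg_cst].
  exact: continuous_dstep.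
by apply: cvgM; [exact: cvg_cst|apply: cvgB; exact: c].
Qed.

Lemma bump_itv k a b t : 0 < k -> a <= b -> 0 <= bump k a b t <= 1.
Proof.
move=> k0 ab; rewrite /bump subr_ge0; apply/andP; split.
  by apply: step_nondecreasing; rewrite ler_pM2l// lerB.
have s0 x : 0 <= step x :> R.
  case: (leP x 0) => x0; first by rewrite step_le0.
  by rewrite -(step_le0 (lexx 0)); exact/step_nondecreasing/ltW.
have s1 x : step x <= 1 :> R.
  case: (leP 2 x) => x0; first by rewrite step_ge2.
  by rewrite -(step_ge2 (lexx 2)); exact/step_nondecreasing/ltW.
by rewrite lerBlDr (le_trans (s1 _))// lerDl.
Qed.

Lemma pbump_left k a b t : 0 < k -> a <= b -> t <= a -> pbump k a b t = 0.
Proof.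
move=> k0 ab ta; rewrite /pbump !pstep_le0 ?subrr ?mulr0//; nra.
Qed.

Lemma pbump_right k a b t : 0 < k -> a <= b -> b + 2 / k <= t ->
  pbump k a b t = b - a.
Proof.
move=> k0 ab; rewrite -lerBrDl ler_pdivrMr// mulrC => bt.
rewrite /pbump !pstep_ge2//; last by nra.
by field; rewrite gt_eqF.
Qed.

Lemma bump_left k a b t : 0 < k -> a <= b -> t <= a -> bump k a b t = 0.
Proof.
move=> k0 ab ta; rewrite /bump !step_le0 ?subrr//; nra.
Qed.

Lemma bump_right k a b t : 0 < k -> a <= b -> b + 2 / k <= t ->
  bump k a b t = 0.
Proof.
move=> k0 ab; rewrite -lerBrDl ler_pdivrMr// mulrC => bt.
by rewrite /bump !step_ge2 ?subrr//; nra.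
Qed.

Lemma bump_mid k a b t : 0 < k -> a + 2 / k <= t -> t <= b -> bump k a b t = 1.
Proof.
move=> k0; rewrite -lerBrDl ler_pdivrMr// mulrC => at_ tb.
by rewrite /bump step_ge2// step_le0 ?subr0//; nra.
Qed.

Lemma dbump_mid k a b t : 0 < k -> a + 2 / k <= t -> t <= b ->
  dbump k a b t = 0.
Proof.
move=> k0; rewrite -lerBrDl ler_pdivrMr// mulrC => at_ tb.
by rewrite /dbump dstep_ge2// dstep_le0 ?subr0 ?mulr0//; nra.
Qed.

Lemma normr_dbump k a b t : 0 < k -> `|dbump k a b t| <= k.
Proof.
move=> k0; rewrite /dbump normrM gtr0_norm// ler_piMr ?(ltW k0)// ler_norml.
have := dstep_itv (k * (t - a)); have := dstep_itv (k * (t - b)); lra.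
Qed.

(** With [k = n + 1] the bump rises on [[a, a + 2 / k]] and falls on [[b, b + 2 / k]]. Both layers
    shrink to their left endpoints, so the sequence is eventually constant at each [t], and the
    limit interval is open at [a] and closed at [b]. *)
Lemma bump_cvg a b t : a < b ->
  bump n.+1%:R a b t @[n --> \oo] --> ((a < t <= b)%R%:R : R).
Proof.
move=> ab; have n0 n : 0 < n.+1%:R :> R by rewrite ltr0n.
have big (c : R) : 0 < c -> \forall n \near \oo, 2 / n.+1%:R <= c.
  move=> c0; near=> n; rewrite ler_pdivrMr// -ler_pdivrMl//.
  rewrite (@le_trans _ _ n%:R) ?ler_nat//.
  near: n; exact: nbhs_infty_ger.
case: (leP t a) => ta /=.
  by apply: cvg_near_cst; apply: nearW => n; rewrite bump_left// ltW.
case: (leP t b) => tb /=; apply: cvg_near_cst.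
  have ta0 : 0 < t - a by rewrite subr_gt0.
  apply: filterS (big _ ta0) => n nt.
  by rewrite bump_mid//; move: nt; rewrite lerBrDl.
have tb0 : 0 < t - b by rewrite subr_gt0.
apply: filterS (big _ tb0) => n nt.
by rewrite bump_right ?(ltW ab)//; move: nt; rewrite lerBrDl.
Unshelve. all: by end_near. Qed.

End bump.

(** * Tensor products of one-variable functions, and cubes *)

Section tensor.
Variables (R : realType) (N : nat).
Local Notation V := 'rV[R]_N.
Implicit Types (f df : 'I_N -> R -> R) (x : V).

Definition tensor f x : R := \prod_(i < N) f i (x ord0 i).

Definition cube (r : R) : set V := [set x | forall i, `|x ord0 i| <= r].

Lemma cubeE r : cube r = [set x : V | forall i, `[- r, r]%classic (x ord0 i)].
Proof.
by apply/seteqP; split=> x xr i; have := xr i; rewrite /= in_itv/= ler_norml.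
Qed.

Lemma compact_cube r : compact (cube r).
Proof.
rewrite cubeE; apply: (@rV_compact R N (fun=> `[- r, r]%classic)) => i.
exact: segment_compact.
Qed.

Lemma cube_bigcap r : cube r = \bigcap_(i in [set: 'I_N])
  ((fun x : V => x ord0 i) @^-1` `[- r, r]%classic).
Proof. by rewrite cubeE; apply/seteqP; split=> x xr i => [_|]; exact: xr. Qed.

Lemma closed_cube r : closed (cube r).
Proof.
rewrite cube_bigcap; apply: closed_bigI => i _.
apply: preimage_closed; last exact: itv_closed.
by move=> x _; exact: coord_continuous.
Qed.

Lemma differentiable_tensor f x :
  (forall i t, derivable (f i) t 1) -> differentiable (tensor f) x.
Proof.
move=> df; rewrite /tensor; elim: (index_enum 'I_N) => [|i s IH].
  under [X in differentiable X _]funext do rewrite big_nil.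
  exact: differentiable_cst.
under [X in differentiable X _]funext do rewrite big_cons.
apply: differentiableM => //.
apply: (@differentiable_comp _ _ _ _ (fun y : V => y ord0 i) (f i)).
  exact: differentiable_coord.
exact/derivable1_diffP.
Qed.

Lemma continuous_tensor f : (forall i, continuous (f i)) ->
  continuous (tensor f).
Proof.
move=> cf; apply: continuous_big; first exact: mul_continuous.
move=> i _ x.
apply: (@continuous_comp _ _ _ (fun y : V => y ord0 i) (f i)).
  exact: coord_continuous.
exact: cf.
Qed.

Definition update f (i : 'I_N) (g : R -> R) : 'I_N -> R -> R :=
  fun j => if j == i then g else f j.

Lemma tensor_update f i g x :
  tensor (update f i g) x = g (x ord0 i) * \prod_(j < N | j != i) f j (x ord0 j).
Proof.
rewrite /tensor (bigD1 i)//= /update eqxx; congr (_ * _).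
by apply: eq_bigr => j /negbTE ->.
Qed.

(** On the line through [x] in direction [i] only the [i]-th factor varies; the others form the
    constant [c]. The two difference quotients [F] and [G] are therefore the same function of
    [h]. *)
Lemma partial_tensor f (g : R -> R) i :
  (forall t, is_derive t (1 : R) (f i) (g t)) ->
  partial i (tensor f) = tensor (update f i g).
Proof.
move=> fdf; apply/funext => x; rewrite tensor_update /partial.
set c := \prod_(j < N | _) _.
have E : 'D_1 (c *: f i) (x ord0 i) = c * g (x ord0 i).
  by have D := fdf (x ord0 i); rewrite derive_val.
rewrite mulrC -E /derive; set F := fun h : R => _; set G := fun h : R => _.
suff -> : F = G by [].
apply/funext => h; rewrite /F /G /=; congr (_ *: _).
have line (y : V) : (forall j, j != i -> y ord0 j = x ord0 j) ->
    tensor f y = c * f i (y ord0 i).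
  move=> yx; rewrite /tensor (bigD1 i)//= mulrC; congr (_ * _).
  by apply: eq_bigr => j ji; rewrite yx.
rewrite !line//; last first.
  by move=> j ji; rewrite !mxE/= (negbTE ji) mulr0 add0r.
by rewrite !mxE/= !eqxx.
Qed.

Lemma tensor_C1_0 f df r :
  (forall i t, is_derive t (1 : R) (f i) (df i t)) ->
  (forall i, continuous (df i)) ->
  (forall i t, r < `|t| -> f i t = 0) ->
  C1_0 (tensor f).
Proof.
move=> fdf cdf f0.
have dfi i t : derivable (f i) t 1 by have [] := fdf i t.
have cf i : continuous (f i).
  by move=> t; apply: differentiable_continuous; exact/derivable1_diffP.
split=> [x|i|]; first exact: differentiable_tensor.
- rewrite (@partial_tensor f (df i) i)//; apply: continuous_tensor => j.
  by rewrite /update; case: ifP.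
- apply: (subclosed_compact _ (@compact_cube r)); first exact: closed_closure.
  rewrite closureE; apply: smallest_sub; first exact: closed_cube.
  move=> x /= fx i; rewrite leNgt; apply: contra fx => ri.
  by rewrite /tensor (bigD1 i)//= f0// mul0r.
Qed.

Lemma measurable_coordinate (i : 'I_N) :
  measurable_fun [set: lebesgue_type R N] (fun x : V => x ord0 i).
Proof.
move=> _ Y mY; rewrite setTI; apply: (lebesgue_RnE _).1.
by rewrite -[X in measurable X]setTI; exact: measurable_rV_coord.
Qed.

Lemma measurable_tensor f : (forall i, continuous (f i)) ->
  measurable_fun [set: lebesgue_type R N] (tensor f).
Proof.
move=> cf; apply: measurable_prod => i _.
apply: (measurableT_comp (continuous_measurable_fun (cf i))).
exact: measurable_coordinate.
Qed.

Lemma measurable_cube r : measurable (cube r : set (lebesgue_type R N)).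
Proof.
rewrite cube_bigcap; apply: fin_bigcap_measurable => // i _.
rewrite -[X in measurable X]setTI; exact: measurable_coordinate.
Qed.

Lemma lebesgue_cube r : 0 <= r ->
  lebesgue_Rn (cube r : set (lebesgue_type R N)) = ((2 * r) ^+ N)%:E.
Proof.
move=> r0.
have [mB B] := @lebesgue_rV_box R N (fun _ => `[- r, r]%classic)
  (fun _ => measurable_itv _).
rewrite cubeE (lebesgue_RnE mB).2 B.
rewrite (eq_bigr (fun=> (2 * r)%:E)) => [|i _]; last first.
  rewrite lebesgue_measure_itv/= lte_fin.
  case: ltP => ?; congr (_%:E); lra.
by rewrite prodEFin big_const_ord iter_mulr_1.
Qed.

End tensor.

(** * Functions with zero weak gradient *)

Section local_integrability.
Variables (R : realType) (N : nat).
Local Notation V := 'rV[R]_N.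
Local Notation mu := (@lebesgue_Rn R N).
Local Notation T := (lebesgue_type R N).
Implicit Types (u f : V -> R) (q r : R).

Lemma lebesgue_cube_lty r : (mu (cube r : set T) < +oo)%E.
Proof.
apply: (@le_lt_trans _ _ (mu (cube (Num.max 0 r) : set T))).
  apply: le_measure; rewrite ?inE; [exact: measurable_cube..|].
  by move=> x xr i; rewrite (le_trans (xr i))// le_max lexx orbT.
by rewrite lebesgue_cube ?ltry// le_max lexx.
Qed.

Lemma Lloc_integrable_powR q f r : 0 < q -> Lloc q f ->
  mu.-integrable (cube r) (EFin \o (fun x => `|f x| `^ q)).
Proof.
move=> q0 [mf fK]; have := fK _ (@compact_cube R N r).
rewrite /finite_norm unlock => fq.
apply/integrableP; split.
  apply/measurable_EFinP/measurable_funTS.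
  by apply: (measurableT_comp (measurable_powR q)); exact: measurableT_comp.
have -> : (\int[mu]_(x in cube r) `|(EFin \o (fun y : V => (`|f y| `^ q)%R)) x| =
    \int[mu]_x `|(EFin \o f \_ (cube r)) x| `^ q)%E.
  rewrite integral_mkcond; apply: eq_integral => x _.
  rewrite /= !patchE; case: ifPn => _ /=.
    by rewrite ger0_norm ?powR_ge0.
  by rewrite normr0 powR0// gt_eqF.
(* The norm is the [q^-1]-th power of this integral, so an infinite integral would make it
   infinite. *)
rewrite ltey; apply/eqP => oo; move: fq; rewrite oo poweRyr ?ltxx//.
by rewrite invr_eq0 gt_eqF.
Qed.

Lemma ler_addr_powR (t q : R) : 1 <= q -> 0 <= t -> t <= 1 + t `^ q.
Proof.
move=> q1 t0; case: (leP t 1) => t1.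
  by rewrite (le_trans t1)// lerDl powR_ge0.
by rewrite (@le_trans _ _ (t `^ q))// ?lerDr//; apply: le1r_powR => //; exact: ltW.
Qed.

Lemma integrable_cst_cube r (c : R) : mu.-integrable (cube r) (EFin \o cst c).
Proof.
apply/integrableP; split; first exact/measurable_EFinP.
rewrite (eq_integral (cst `|c|%:E))//= integral_cst; last exact: measurable_cube.
by rewrite lte_mul_pinfty ?lee_fin// lebesgue_cube_lty.
Qed.

(** On a cube, which has finite measure, [1 + |f|^q] is an integrable majorant of [|f|]. *)
Lemma Lloc_integrable q f r : 1 <= q -> Lloc q f ->
  mu.-integrable (cube r) (EFin \o f).
Proof.
move=> q1 fq.
have q0 : 0 < q by apply: lt_le_trans q1.
apply: (@le_integrable _ _ _ mu _ (measurable_cube r) _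
    ((EFin \o cst 1%R) \+ (EFin \o (fun x => (`|f x| `^ q)%R)))%E).
- by case: fq => mf _; exact/measurable_EFinP/measurable_funTS.
- move=> x _ /=; rewrite lee_fin [leRHS]ger0_norm; last first.
    by rewrite addr_ge0// powR_ge0.
  exact: ler_addr_powR.
- apply: integrableD; first exact: measurable_cube.
    exact: integrable_cst_cube.
  exact: Lloc_integrable_powR.
Qed.

Lemma integrable_mul_bounded r M u f :
  mu.-integrable (cube r) (EFin \o u) ->
  measurable_fun [set: T] u -> measurable_fun [set: T] f ->
  (forall x, `|f x| <= M) -> (forall x, ~ cube r x -> f x = 0) ->
  mu.-integrable [set: T] (EFin \o (fun x => u x * f x)).
Proof.
move=> iu mu_ mf fM f0.
apply: (@le_integrable _ _ _ mu _ measurableT _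
  (fun x => M%:E * (((EFin \o u) \_ (cube r)) x))%E).
- by apply/measurable_EFinP; exact: measurable_funM.
- move=> x _ /=; rewrite patchE; case: ifPn => xr.
    rewrite -EFinM abse_EFin lee_fin !normrM mulrC ler_wpM2r//.
    by rewrite (le_trans (fM x))// ler_norm.
  by rewrite f0 ?mulr0 ?normr0 ?abse_ge0//; move/negP: xr; rewrite inE.
- apply: integrableZl => //.
  by apply/(integrable_mkcond _ (measurable_cube r)).
Qed.

End local_integrability.

(** * Exchanging one bump for another under a zero weak gradient *)

Section box_average.
Variables (R : realType) (N : nat).
Local Notation V := 'rV[R]_N.
Local Notation mu := (@lebesgue_Rn R N).
Local Notation T := (lebesgue_type R N).
Variable u : V -> R.
Hypothesis mu_ : measurable_fun [set: T] u.
Hypothesis iu : forall r, mu.-integrable (cube r) (EFin \o u).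
Hypothesis u0 : forall (i : 'I_N) phi, C1_0 phi ->
  measurable_fun [set: T] phi ->
  \int[mu]_x (u x * partial i phi x) = 0.

Lemma tensor_eq0 (f : 'I_N -> R -> R) r :
  (forall i t, r < `|t| -> f i t = 0) ->
  forall x, ~ cube r x -> tensor f x = 0.
Proof.
move=> f0 x /existsNP[i /negP]; rewrite -ltNge => ri.
by rewrite /tensor (bigD1 i)//= f0// mul0r.
Qed.

Lemma normr_tensor_le1 (f : 'I_N -> R -> R) :
  (forall i t, `|f i t| <= 1) -> forall x, `|tensor f x| <= 1.
Proof.
move=> f1 x; rewrite /tensor normr_prod; apply: prodr_ile1 => i _.
by rewrite normr_ge0 f1.
Qed.

(* The test function has [pbump k a b - (b - a) pbump k 0 1] as its i-th factor,
   which has compact support. *)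
Lemma bump_exchange (f : 'I_N -> R -> R) (df : 'I_N -> R -> R) i k a b r :
  0 < k -> a <= b ->
  (forall j t, is_derive t (1 : R) (f j) (df j t)) ->
  (forall j, continuous (df j)) ->
  (forall j t, `|f j t| <= 1) ->
  (forall j t, r < `|t| -> f j t = 0) ->
  - r <= a -> b + 2 / k <= r -> 0 <= r -> 1 + 2 / k <= r ->
  \int[mu]_x (u x * tensor (update f i (bump k a b)) x) =
  (b - a) * \int[mu]_x (u x * tensor (update f i (bump k 0 1)) x).
Proof.
move=> k0 ab fdf cdf f1 f0 ra br r0 r1.
have kn0 : k != 0 by rewrite gt_eqF.
pose g := pbump k a b - (b - a) *: pbump k 0 1.
pose dg := bump k a b - (b - a) *: bump k 0 1.
have gdg t : is_derive t (1 : R) g (dg t).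
  have D1 := is_derive_pbump a b t kn0.
  have D2 := is_derive_pbump 0 1 t kn0.
  by apply: is_derive_eq.
have cb c d : continuous (bump k c d).
  move=> t; apply: differentiable_continuous; apply/derivable1_diffP.
  by have [] := is_derive_bump k c d t.
have cf j : continuous (f j).
  move=> t; apply: differentiable_continuous; apply/derivable1_diffP.
  by have [] := fdf j t.
have c01 : continuous dg.
  move=> t; apply: cvgB; first exact: cb.
  by apply: cvgZ; [exact: cvg_cst|exact: cb].
have b0 c d t : c <= d -> - r <= c -> d + 2 / k <= r -> r < `|t| ->
    bump k c d t = 0.
  move=> cd rc dr; rewrite lter_normr => /orP[rt|rt].
    by rewrite bump_right// (le_trans dr)// ltW.
  by rewrite bump_left//; lra.
(* To the right of both supports the primitives equal [b - a] and [1], so the two terms of [g]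
   cancel; to the left both vanish. *)
have g0 t : r < `|t| -> g t = 0.
  rewrite /g -[LHS]/(pbump k a b t - (b - a) * pbump k 0 1 t) lter_normr.
  move=> /orP[rt|rt].
    rewrite !pbump_right ?ler01//; [lra| |]; exact/ltW/(le_lt_trans _ rt).
  by rewrite !pbump_left ?ler01 ?mulr0 ?subrr//; lra.
have C1 : C1_0 (tensor (update f i g)).
  apply: (@tensor_C1_0 _ _ _ (update df i dg) r).
  - by move=> j t; rewrite /update; case: ifP.
  - by move=> j; rewrite /update; case: ifP.
  - by move=> j t; rewrite /update; case: ifP => // _; [exact: g0|exact: f0].
have itg c d : c <= d -> - r <= c -> d + 2 / k <= r ->
  mu.-integrable [set: T]
    (EFin \o (fun x => u x * tensor (update f i (bump k c d)) x)).
  move=> cd rc dr; apply: (@integrable_mul_bounded _ _ r 1) => //.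
  - by apply: measurable_tensor => j; rewrite /update; case: ifP.
  - apply: normr_tensor_le1 => j t; rewrite /update; case: ifP => // _.
    by have /andP[b0_ b1] := bump_itv t k0 cd; rewrite ger0_norm.
  - apply: tensor_eq0 => j t rt; rewrite /update; case: ifP => // _.
      exact: b0.
    exact: f0.
have cg : continuous g.
  move=> t; apply: differentiable_continuous; apply/derivable1_diffP.
  by have [] := gdg t.
have mg : measurable_fun [set: T] (tensor (update f i g)).
  by apply: measurable_tensor => j; rewrite /update; case: ifP.
have := u0 i C1 mg.
have -> : partial i (tensor (update f i g)) = tensor (update (update f i g) i dg).
  by apply: partial_tensor => t; rewrite /update eqxx.
have -> : (fun x => u x * tensor (update (update f i g) i dg) x) =
  (fun x => u x * tensor (update f i (bump k a b)) x -
     (b - a) * (u x * tensor (update f i (bump k 0 1)) x)).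
  apply/funext => x; rewrite !tensor_update.
  have -> : \prod_(j < N | j != i) update f i g j (x ord0 j) =
            \prod_(j < N | j != i) f j (x ord0 j).
    by apply: eq_bigr => j /negbTE ji; rewrite /update ji.
  rewrite /dg -[X in u x * (X * _)]/(bump k a b (x ord0 i) -
    (b - a) * bump k 0 1 (x ord0 i)); ring.
rewrite RintegralB//; first last.
- have := integrableZl measurableT (b - a) (itg 0 1 ler01 _ _).
  apply; lra.
- exact: itg.
rewrite RintegralZl//; first by move/eqP; rewrite subr_eq0 => /eqP.
by apply: itg => //; lra.
Qed.

End box_average.

(** * Averages over boxes *)

Section box_average_limit.
Variables (R : realType) (N : nat).
Local Notation V := 'rV[R]_N.
Local Notation mu := (@lebesgue_Rn R N).
Local Notation T := (lebesgue_type R N).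

(** Half-open sides match the pointwise limit of the bumps. *)
Definition box (a b : 'I_N -> R) : set V :=
  [set x | forall i, a i < x ord0 i <= b i].

Lemma boxE a b :
  box a b = [set x : V | forall i, `]a i, b i]%classic (x ord0 i)].
Proof. by apply/seteqP; split=> x xr i; have := xr i; rewrite /= in_itv. Qed.

Lemma borel_box a b : measurable (box a b).
Proof.
rewrite boxE.
exact: (@lebesgue_rV_box R N (fun i => `]a i, b i]%classic)
  (fun i => measurable_itv _)).1.
Qed.

Lemma measurable_box a b : measurable (box a b : set T).
Proof. exact: (lebesgue_RnE (borel_box a b)).1. Qed.

Lemma lebesgue_box a b : (forall i, a i <= b i) ->
  mu (box a b : set T) = (\prod_(i < N) (b i - a i))%:E.
Proof.
move=> ab.
rewrite (lebesgue_RnE (borel_box a b)).2 boxE.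
rewrite (@lebesgue_rV_box R N (fun i => `]a i, b i]%classic)
  (fun i => measurable_itv _)).2 -prodEFin.
apply: eq_bigr => i _; rewrite lebesgue_measure_itv/= lte_fin.
by case: ltP => // ba; congr (_%:E); have := ab i; lra.
Qed.

(** The margin 2 leaves room for the layers of width [2 / k] when [1 <= k], and [3 <= r] does the
    same for the unit bumps on [[0, 1]], so one cube contains the supports of all tensors used for
    this box. *)
Lemma box_sub_cube a b : exists2 r : R, 3 <= r &
  [/\ forall i, - r <= a i - 2, forall i, b i + 2 <= r & box a b `<=` cube r].
Proof.
pose r := 3 + \sum_i (`|a i| + `|b i|).
have S i : `|a i| + `|b i| <= \sum_i (`|a i| + `|b i|).
  by rewrite (bigD1 i)//= lerDl sumr_ge0.
exists r; first by rewrite lerDl sumr_ge0.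
have Ha i : - r <= a i - 2.
  have := S i; have := ler_norm (- a i); rewrite normrN /r.
  have := normr_ge0 (b i); lra.
have Hb i : b i + 2 <= r.
  have := S i; have := ler_norm (b i); rewrite /r.
  have := normr_ge0 (a i); lra.
split => // x xab i; rewrite ler_norml.
have /andP[ax xb] := xab i; have := Ha i; have := Hb i; lra.
Qed.

Variable u : V -> R.
Hypothesis mu_ : measurable_fun [set: T] u.
Hypothesis iu : forall r, mu.-integrable (cube r) (EFin \o u).

(** Dominated convergence: every tensor is at most 1 and supported in the same cube, so [|u|]
    restricted to that cube is a majorant. *)
Lemma cvg_bump_box a b : (forall i, a i < b i) ->
  \int[mu]_x (u x * tensor (fun i => bump n.+1%:R (a i) (b i)) x) @[n --> \oo]
    --> \int[mu]_(x in box a b) u x.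
Proof.
move=> ab; have [r r3 [ra rb abr]] := box_sub_cube a b.
have cb k c d : continuous (@bump R k c d).
  move=> t; apply: differentiable_continuous; apply/derivable1_diffP.
  by have [] := is_derive_bump k c d t.
pose h n x := u x * tensor (fun i => bump n.+1%:R (a i) (b i)) x.
have mh n : measurable_fun [set: T] (EFin \o h n).
  apply/measurable_EFinP/measurable_funM => //.
  by apply: measurable_tensor.
have n0 n : 0 < n.+1%:R :> R by rewrite ltr0n.
have b1 n i t : `|bump n.+1%:R (a i) (b i) t| <= 1.
  have /andP[B0 B1] := bump_itv t (n0 n) (ltW (ab i)).
  by rewrite ger0_norm.
have b0 n i t : r < `|t| -> bump n.+1%:R (a i) (b i) t = 0.
  have n2 : 2 / n.+1%:R <= 2 :> R.
    by rewrite ler_pdivrMr// ler_peMr// ler1n.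
  rewrite lter_normr => /orP[rt|rt].
    rewrite bump_right// ?(ltW (ab i))//; apply/ltW/(le_lt_trans _ rt).
    by rewrite (le_trans _ (rb i))// lerD2l.
  by rewrite bump_left// ?(ltW (ab i))//; have := ra i; lra.
have mB := measurable_box a b.
have iuB : mu.-integrable (box a b) (EFin \o u).
  exact: integrableS (measurable_cube r) mB abr (iu r).
have mf : measurable_fun [set: T] ((EFin \o u) \_ (box a b)).
  by apply: (measurable_int mu); apply/(integrable_mkcond _ mB).
have hf : {ae mu, forall x, [set: T] x ->
    (EFin \o h n) x @[n --> \oo] --> ((EFin \o u) \_ (box a b)) x}.
  apply: aeW => /= x _.
  have -> : ((EFin \o u) \_ (box a b)) x =
      (u x * \prod_(i < N) (a i < x ord0 i <= b i)%R%:R)%:E.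
    rewrite patchE; case: ifPn => /= [/set_mem xab|/negP xab].
      by rewrite big1 ?mulr1// => i _; rewrite xab.
    have [i xi] : exists i, ~ (a i < x ord0 i <= b i).
      by apply/existsNP => H; apply: xab; rewrite inE.
    by rewrite (bigD1 i)//= (introF idP xi) mul0r mulr0.
  apply: cvg_EFin; first exact: nearW.
  apply: cvgM; first exact: cvg_cst.
  apply: cvg_big; first exact: mul_continuous.
  by move=> i _; exact: bump_cvg.
have ig : mu.-integrable [set: T] (abse \o ((EFin \o u) \_ (cube r))).
  apply: integrable_abse; apply/(integrable_mkcond _ (measurable_cube r)).
  exact: iu.
have hg : {ae mu, forall x n, [set: T] x ->
    (`|(EFin \o h n) x| <= (abse \o ((EFin \o u) \_ (cube r))) x)%E}.
  apply: aeW => /= x n _; rewrite patchE; case: ifPn => xr /=.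
    rewrite lee_fin normrM ler_piMr//.
    by apply: normr_tensor_le1 => i t; exact: b1.
  rewrite /h (tensor_eq0 (b0 n)) ?mulr0 ?normr0//.
  by move/negP: xr; rewrite inE.
have [_ _ cv] := dominated_convergence measurableT mh mf hf ig hg.
apply: fine_cvg; rewrite fineK ?integrable_fin_num// integral_mkcond.
exact: cv.
Qed.

Lemma bump_average (k : R) a b : 1 <= k -> (forall i, a i <= b i) ->
  (forall (i : 'I_N) phi, C1_0 phi -> measurable_fun [set: T] phi ->
    \int[mu]_x (u x * partial i phi x) = 0) ->
  \int[mu]_x (u x * tensor (fun i => bump k (a i) (b i)) x) =
  \prod_(i < N) (b i - a i) * \int[mu]_x (u x * tensor (fun=> bump k 0 1) x).
Proof.
move=> k1 ab u0; have [r r3 [ra rb _]] := box_sub_cube a b.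
have k0 : 0 < k by apply: lt_le_trans k1.
have k2 : 2 / k <= 2 by rewrite ler_pdivrMr// ler_peMr.
pose f (s : seq 'I_N) j := if j \in s then bump k 0 1 else bump k (a j) (b j).
pose df (s : seq 'I_N) j := if j \in s then dbump k 0 1 else dbump k (a j) (b j).
(* [s] lists the coordinates whose bump has already been replaced by the unit one. Each replacement
   is one use of [bump_exchange] and costs the factor [b i - a i]. *)
suff H (s : seq 'I_N) : uniq s -> \int[mu]_x (u x * tensor (f [::]) x) =
    \prod_(i <- s) (b i - a i) * \int[mu]_x (u x * tensor (f s) x).
  have -> : (fun i => bump k (a i) (b i)) = f [::] by [].
  rewrite (H (index_enum 'I_N)) ?index_enum_uniq//.
  by have -> : f (index_enum 'I_N) = (fun=> bump k 0 1)
    by apply/funext => i; rewrite /f mem_index_enum.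
elim: s => [|i s IH]; first by rewrite big_nil mul1r.
move=> /= /andP[si us]; rewrite IH// big_cons [_ * \prod_(_ <- _) _]mulrC -mulrA.
congr (_ * _).
have -> : f s = update (f s) i (bump k (a i) (b i)).
  by apply/funext => j; rewrite /update /f; case: eqP => // ->; rewrite (negbTE si).
have -> : f (i :: s) = update (f s) i (bump k 0 1).
  by apply/funext => j; rewrite /update /f in_cons; case: eqP.
have f0 c d t : c <= d -> - r <= c -> d + 2 <= r -> r < `|t| ->
    bump k c d t = 0.
  move=> cd rc dr; rewrite lter_normr => /orP[rt|rt].
    by rewrite bump_right//; lra.
  by rewrite bump_left//; lra.
apply: (@bump_exchange _ _ _ mu_ iu u0 (f s) (df s) i k _ _ r) => //.
- by move=> j t; rewrite /f /df; case: ifP => _; exact: is_derive_bump.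
- by move=> j; rewrite /df; case: ifP => _; exact: continuous_dbump.
- move=> j t; rewrite /f; case: ifP => _.
    by have /andP[? ?] := bump_itv t k0 (@ler01 R); rewrite ger0_norm.
  by have /andP[? ?] := bump_itv t k0 (ab j); rewrite ger0_norm.
- move=> j t rt; rewrite /f; case: ifP => _; apply: f0 => //; try lra.
  by have := ra j; lra.
- by have := ra i; lra.
- by have := rb i; lra.
- by lra.
- by lra.
Qed.

Lemma box_average a b : (forall i, a i < b i) ->
  (forall (i : 'I_N) phi, C1_0 phi -> measurable_fun [set: T] phi ->
    \int[mu]_x (u x * partial i phi x) = 0) ->
  \int[mu]_(x in box a b) u x =
  \prod_(i < N) (b i - a i) * \int[mu]_(x in box (fun=> 0) (fun=> 1)) u x.
Proof.
move=> ab u0; have cab := cvg_bump_box ab.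
have c01 := @cvg_bump_box (fun=> 0) (fun=> 1) (fun=> @ltr01 R).
have := cvgM (cvg_cst (\prod_(i < N) (b i - a i))) c01.
set F := (F in F @ _ --> _) => cF; move: cab.
have -> : (fun n => \int[mu]_x
    (u x * tensor (fun i => bump n.+1%:R (a i) (b i)) x)) = F.
  apply/funext => n; rewrite bump_average//; first by rewrite ler1n.
  by move=> i; exact/ltW.
by move=> /cvg_lim <- //; apply: (cvg_lim _ (cF _ _)).
Qed.

(** The unit box has measure 1, so the subtracted integral is the common average of [u] over all
    boxes. *)
Lemma integral_box_eq a b : (forall i, a i < b i) ->
  (forall (i : 'I_N) phi, C1_0 phi -> measurable_fun [set: T] phi ->
    \int[mu]_x (u x * partial i phi x) = 0) ->
  (\int[mu]_(x in box a b)
     (u x - \int[mu]_(x in box (fun=> 0%R) (fun=> 1%R)) u x)%:E = 0)%E.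
Proof.
move=> ab u0; set c := \int[mu]_(x in _) _.
have [r r3 [ra rb abr]] := box_sub_cube a b.
have mB := measurable_box a b.
have iuB : mu.-integrable (box a b) (EFin \o u).
  exact: integrableS (measurable_cube r) mB abr (iu r).
have icB : mu.-integrable (box a b) (EFin \o cst c).
  exact: integrableS (measurable_cube r) mB abr (@integrable_cst_cube R N r c).
have -> : (\int[mu]_(x in box a b) (u x - c)%:E =
    \int[mu]_(x in box a b) (u x)%:E - c%:E * mu (box a b : set T))%E.
  by rewrite integralB_EFin// integral_cst.
rewrite lebesgue_box => [|i]; last exact/ltW.
rewrite -[X in (X - _)%E]fineK ?integrable_fin_num//.
rewrite -[fine _]/(\int[mu]_(x in box a b) u x) box_average//.
by rewrite -EFinM -EFinB mulrC subrr.
Qed.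

End box_average_limit.

(** * Functions whose integral vanishes on every box *)

Section vanishing_box_integrals.
Variables (R : realType) (N : nat).
Local Notation V := 'rV[R]_N.
Local Notation mu := (@lebesgue_Rn R N).
Local Notation T := (lebesgue_type R N).

Definition boxes : set (set V) := [set B | exists a b, B = box a b].

Lemma measurable_boxesE : @measurable _ V = <<s boxes >>.
Proof.
apply/seteqP; split; last first.
  apply: smallest_sub; first exact: sigma_algebra_measurable.
  by move=> _ [a [b ->]]; exact: borel_box.
apply: smallest_sub; first exact: smallest_sigma_algebra.
rewrite -bigcup_seq => _ [i _] [Y mY <-].
have : measurable_fun [set: g_sigma_algebraType boxes] (@rV_coord R N i).
  apply: (measurability _ (RGenOInfty.measurableE R)).
  move=> _ [_ [t ->] <-]; rewrite setTI.
  (* The half-space [t < x_i] is exhausted by boxes with side []t, n]] in direction [i] and []-n,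
     n]] in the others. An integer above the sum of the [|x_j|] bounds every coordinate of [x]. *)
  have -> : @rV_coord R N i @^-1` `]t, +oo[%classic =
      \bigcup_n box (fun j => if j == i then t else - n%:R) (fun=> n%:R).
    apply/seteqP; split=> x /=; rewrite /rV_coord in_itv/= andbT.
      move=> tx; exists (Num.truncn (\sum_j `|x ord0 j|)).+1 => //= j.
      have xn : `|x ord0 j| < (Num.truncn (\sum_j `|x ord0 j|)).+1%:R.
        apply: le_lt_trans (truncnS_gt _).
        by rewrite (bigD1 j)//= lerDl sumr_ge0.
      move: xn; rewrite ltr_norml => /andP[x1 x2].
      by rewrite (ltW x2) andbT; case: eqP => [->|].
    by move=> [n _ /(_ i)]; rewrite eqxx => /andP[].
  apply: bigcupT_measurable => n; apply: sub_sigma_algebra.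
  by eexists; eexists.
by move=> H; exact: H.
Qed.

Lemma setI_closed_boxes : setI_closed boxes.
Proof.
move=> _ _ [a [b ->]] [c [d ->]].
exists (fun i => Num.max (a i) (c i)), (fun i => Num.min (b i) (d i)).
apply/seteqP; split=> [x [xab xcd] i|x H].
  have /andP[? ?] := xab i; have /andP[? ?] := xcd i.
  by rewrite gt_max le_min; apply/andP; split; apply/andP.
by split=> i; have := H i; rewrite gt_max le_min => /andP[/andP[? ?] /andP[? ?]];
  apply/andP.
Qed.

(** [A] is the intersection of Borel supersets of [E] whose measures exceed that of [E] by at most
    [1 / (n + 1)]. Finiteness of the measure of [E] allows the subtraction at the end. *)
Lemma lebesgue_outer_borel (E : set T) : measurable E -> (mu E < +oo)%E ->
  exists2 A : set V, measurable A & E `<=` A /\ mu (A `\` E : set T) = 0%E.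
Proof.
move=> mE Eoo.
have Efin : mu E \is a fin_num by rewrite ge0_fin_numE.
have cov n : exists2 U : set V, measurable U &
    E `<=` U /\ (mu (U : set T) <= mu E + n.+1%:R^-1%:E)%E.
  have n0 : 0 < n.+1%:R^-1 :> R by rewrite invr_gt0 ltr0n.
  (* By construction [mu E] is the infimum of the sums of measures over countable Borel covers of
     [E]. *)
  have [_ [F [mF EF] <-] Fle] := lb_ereal_inf_adherent n0 Efin.
  exists (\bigcup_k F k); first exact: bigcupT_measurable.
  split => //; apply: le_trans (ltW Fle).
  apply: (le_trans (outer_measure_sigma_subadditive _ F)).
  apply: lee_nneseries => // k _.
  rewrite le_eqVlt; apply/orP; left; apply/eqP.
  exact: (lebesgue_RnE (mF k)).2.
pose U n := sval (cid2 (cov n)).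
have mU n : measurable (U n) by rewrite /U; case: cid2.
have EU n : E `<=` U n by rewrite /U; case: cid2 => /= ? _ [].
have muU n : (mu (U n : set T) <= mu E + n.+1%:R^-1%:E)%E.
  by rewrite /U; case: cid2 => /= ? _ [].
have mA : measurable (\bigcap_n U n) by exact: bigcapT_measurable.
exists (\bigcap_n U n) => //.
have EA : E `<=` \bigcap_n U n by move=> x Ex n _; exact: EU.
split => //.
have mAT : measurable (\bigcap_n U n : set T) by exact: (lebesgue_RnE mA).1.
have muA : (mu (\bigcap_n U n : set T) <= mu E)%E.
  apply/lee_addgt0Pr => e e0.
  near \oo => n.
  apply: (@le_trans _ _ (mu (U n : set T))).
    apply: le_measure; rewrite ?inE//; first exact: (lebesgue_RnE (mU n)).1.
    exact: bigcap_inf.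
  apply: (le_trans (muU n)); rewrite leeD2l// lee_fin ltW//.
  by near: n; exact: near_infty_natSinv_lt (PosNum e0).
rewrite measureD//; last exact: le_lt_trans Eoo.
rewrite setIidr//; apply/eqP; rewrite eq_le; apply/andP; split.
  by rewrite leeBlDr// add0e.
by rewrite leeBrDr// add0e le_measure// inE.
Unshelve. all: by end_near. Qed.

Variable f : V -> R.
Hypothesis fi : forall r, mu.-integrable (cube r) (EFin \o f).
Hypothesis f0 : forall a b, (forall i, a i < b i) ->
  (\int[mu]_(x in box a b) (f x)%:E = 0)%E.

(** A box with [b i <= a i] for some [i] is empty. Such boxes arise as intersections of boxes, hence
    the need to include them. *)
Lemma integral_box_eq0 a b : (\int[mu]_(x in box a b) (f x)%:E = 0)%E.
Proof.
have [ab|/existsNP[i /negP]] := pselect (forall i, a i < b i); first exact: f0.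
rewrite -leNgt => ba.
suff -> : box a b = set0 by rewrite integral_set0.
apply/seteqP; split=> x //= /(_ i) /andP[ax xb].
by have := lt_le_trans ax (le_trans xb ba); rewrite ltxx.
Qed.

(** Dynkin's theorem: boxes are stable under intersection and generate the Borel sets. Working
    inside a fixed box keeps [f] integrable, which the steps for complements and disjoint unions
    rely on. *)
Lemma integral_borel_eq0 a b (A : set V) : measurable A ->
  (\int[mu]_(x in box a b `&` A) (f x)%:E = 0)%E.
Proof.
have [r _ [_ _ abr]] := box_sub_cube a b.
have mB := measurable_box a b.
have fB : mu.-integrable (box a b) (EFin \o f).
  exact: integrableS (measurable_cube r) mB abr (fi r).
rewrite measurable_boxesE.
apply: (@dynkin_induction _ V boxes (fun A : set V =>
  (\int[mu]_(x in box a b `&` A) (f x)%:E = 0)%E)).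
- exact: measurable_boxesE.
- exact: setI_closed_boxes.
- by rewrite setIT integral_box_eq0.
- move=> C GC.
  have [c [d ->]] : boxes (box a b `&` C).
    by apply: setI_closed_boxes => //; exists a, b.
  exact: integral_box_eq0.
- move=> S /lebesgue_RnE[mS _] S0; have := integral_box_eq0 a b.
  have mBS : measurable (box a b `&` S : set T) by exact: measurableI.
  have mBC : measurable (box a b `&` ~` S : set T).
    by apply: measurableI => //; exact: measurableC.
  have dBS : [disjoint box a b `&` S & box a b `&` ~` S].
    by apply/disj_setPS => x [[_ ?] []].
  have BE : (box a b `&` S) `|` (box a b `&` ~` S) = box a b.
    by rewrite -setIUr setUCr setIT.
  rewrite -[X in (\int[mu]_(x in X) _)%E]BE integral_setU_EFin//; last first.
    by rewrite BE; apply/measurable_EFinP; exact: (measurable_int mu fB).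
  by rewrite S0 add0e.
- move=> F mF tF F0; rewrite setI_bigcupr integral_bigcup//.
  + by apply: eseries0 => n _ _; exact: F0.
  + exact: trivIset_setIl.
  + by move=> k; apply: measurableI => //; exact: (lebesgue_RnE (mF k)).1.
  + rewrite -setI_bigcupr; apply: (integrableS mB _ _ fB) => //.
    apply: measurableI; first exact: mB.
    have mU : measurable (\bigcup_i F i : set V) by exact: bigcupT_measurable.
    exact: (lebesgue_RnE mU).1.
Qed.

(** A bounded Lebesgue measurable set differs from a Borel set by a null set, which does not affect
    the integral. *)
Lemma integral_lebesgue_eq0 a b (E : set T) : measurable E ->
  E `<=` box a b -> (\int[mu]_(x in E) (f x)%:E = 0)%E.
Proof.
move=> mE Eab; have [r _ [_ _ abr]] := box_sub_cube a b.
have mB := measurable_box a b.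
have fB : mu.-integrable (box a b) (EFin \o f).
  exact: integrableS (measurable_cube r) mB abr (fi r).
have Eoo : (mu E < +oo)%E.
  apply: (@le_lt_trans _ _ (mu (cube r : set T))); last exact: lebesgue_cube_lty.
  apply: le_measure; rewrite ?inE//; first exact: measurable_cube.
  exact: subset_trans abr.
have [A mA [EA AE0]] := lebesgue_outer_borel mE Eoo.
have mAT := (lebesgue_RnE mA).1.
rewrite -(integral_borel_eq0 a b mA).
have mBA : measurable (box a b `&` A : set T) by exact: measurableI.
have fBA : mu.-integrable (box a b `&` A) (EFin \o f).
  by apply: (integrableS mB _ _ fB).
have mAE : measurable (A `\` E : set T) by exact: measurableD.
rewrite [RHS](negligible_integral mAE mBA fBA AE0).
congr (\int[mu]_(x in _) _)%E; apply/seteqP; split=> x.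
  by move=> Ex; split; [split; [exact: Eab|exact: EA]|case].
by move=> [[_ Ax] AEx]; apply: contrapT => Ex; exact: AEx.
Qed.

(** On each box []-n, n]^N] an integrable function with zero integral over all measurable subsets is
    zero a.e., and countably many such boxes cover the space. *)
Lemma vanishing_box_integrals_ae : {ae mu, forall x, f x = 0}.
Proof.
pose B n : set T := box (fun=> - n%:R) (fun=> n%:R).
have aeB n : ae_eq mu (B n) (EFin \o f) (cst 0%E).
  have mB := @measurable_box R N (fun=> - n%:R) (fun=> n%:R).
  have [r _ [_ _ abr]] := @box_sub_cube R N (fun=> - n%:R) (fun=> n%:R).
  apply: integral_ae_eq => //.
    exact: integrableS (measurable_cube r) mB abr (fi r).
  by move=> E EB mE; rewrite integral0 (integral_lebesgue_eq0 mE EB).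
have := ae_foralln aeB.
apply: filterS => x H.
pose n := (Num.truncn (\sum_j `|x ord0 j|)).+1.
have xB : B n x.
  move=> j; have xn : `|x ord0 j| < n%:R.
    apply: le_lt_trans (truncnS_gt _).
    by rewrite (bigD1 j)//= lerDl sumr_ge0.
  move: xn; rewrite ltr_norml => /andP[x1 x2].
  by rewrite x1 ltW.
by have [] := H n xB.
Qed.

End vanishing_box_integrals.

Lemma lebesgue_ae_imp (R : realType) (N : nat) (P Q : 'rV[R]_N -> Prop) :
  (forall x, P x -> Q x) ->
  {ae @lebesgue_Rn R N, forall x, P x} -> {ae @lebesgue_Rn R N, forall x, Q x}.
Proof. by move=> PQ; apply: negligibleS => x /= nQ Px; exact/nQ/PQ. Qed.

Lemma weak_gradient0_ae_constant (R : realType) (N : nat) (p : R)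
    (u : 'rV[R]_N -> R) (G : 'rV[R]_N -> 'rV[R]_N) : 1 <= p ->
  W1p_loc p u G -> {ae @lebesgue_Rn R N, forall x, G x = 0} -> ae_constant u.
Proof.
move=> p1 [uL GL uG] G0.
have mu_ := uL.1.
have iu r := Lloc_integrable r p1 uL.
(* Measurability of [phi] is what makes the a.e. zero integrand [G * phi] measurable; the test
   functions used later are tensors, for which it is known. *)
have u0 i phi : C1_0 phi ->
    measurable_fun [set: lebesgue_type R N] phi ->
    \int[@lebesgue_Rn R N]_x (u x * partial i phi x) = 0.
  move=> C1 mphi; rewrite uG// /Rintegral.
  have mGphi : measurable_fun [set: lebesgue_type R N]
      (fun x => (G x ord0 i * phi x)%:E).
    apply/measurable_EFinP; apply: measurable_funM; last exact: mphi.
    exact: (GL i).1.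
  rewrite (ae_eq_integral (cst 0%E) _ measurableT mGphi (measurable_cst _)).
    by rewrite integral0 oppr0.
  by apply: lebesgue_ae_imp G0 => x -> _; rewrite mxE mul0r.
pose c := \int[@lebesgue_Rn R N]_(x in box (fun=> 0) (fun=> 1)) u x.
exists c.
have : {ae @lebesgue_Rn R N, forall x, u x - c = 0}.
  apply: vanishing_box_integrals_ae.
  - move=> r.
    have ic := @integrable_cst_cube R N r c.
    have := integrableB (measurable_cube r) (iu r) ic.
    by apply: eq_integrable; first exact: measurable_cube.
  - by move=> a b ab; exact: integral_box_eq.
by apply: lebesgue_ae_imp => x /eqP; rewrite subr_eq0 => /eqP.
Qed.

(** * Young's inequality and the limit argument *)

Section real_inequalities.
Variable R : realType.
Implicit Types (b c d g q z alpha gamma : R).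

Let powR_split (x r s : R) : 0 < x -> x `^ (r + s) = x `^ r * x `^ s.
Proof. by move=> x0; apply: powRD; apply/implyP => _; rewrite gt_eqF. Qed.

(** Young's inequality for the conjugate exponents [gamma / alpha] and [q], with weight [d]. The
    factor [z ^+ m] comes from the gradient of [z ^+ m.+1]; the assumption [q <= m + 1] allows the
    right-hand side to keep the full power [z ^+ m.+1]. *)
Lemma young_cutoff alpha gamma q g b z d m :
  0 < alpha -> alpha < gamma -> q = gamma / (gamma - alpha) ->
  q <= m.+1%:R -> 0 <= g -> 0 <= b -> 0 <= z <= 1 -> 0 < d ->
  g `^ alpha * (b * z ^+ m) <=
  d * (g `^ gamma * z ^+ m.+1) + d `^ (1 - q) * b `^ q.
Proof.
move=> a0 ag qE qm g0 b0 /andP[z0 z1] d0.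
have ga0 : 0 < gamma - alpha by rewrite subr_gt0.
have q1 : 1 < q by rewrite qE ltr_pdivlMr// mul1r ltrBlDr ltrDl.
have aE : (gamma - alpha) * (q - 1) = alpha.
  by rewrite qE; field; rewrite gt_eqF.
have rhs0 : 0 <= d * (g `^ gamma * z ^+ m.+1) + d `^ (1 - q) * b `^ q.
  by rewrite addr_ge0// mulr_ge0 ?powR_ge0// ?(ltW d0)// mulr_ge0 ?powR_ge0 ?exprn_ge0.
have m0 : (0 < m)%N.
  by rewrite lt0n; apply/eqP => m0; move: qm; rewrite m0 leNgt q1.
(* The left-hand side vanishes when [g], [z] or [b] is zero; for [z] this uses [0 < m]. Positivity
   is then available to split real powers. *)
move: g0; rewrite le_eqVlt => /predU1P[g0|g0].
  by subst g; rewrite [X in X * _]powR0 ?gt_eqF// mul0r.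
move: z0; rewrite le_eqVlt => /predU1P[z0|z0].
  by subst z; rewrite [X in b * X]expr0n gtn_eqF// !mulr0.
move: b0; rewrite le_eqVlt => /predU1P[b0|b0].
  by subst b; rewrite mul0r mulr0.
(* The two sides of this comparison decide which term of the bound is used. *)
have [bd|bd] := leP b (d * g `^ (gamma - alpha) * z).
  rewrite (@le_trans _ _ (d * (g `^ gamma * z ^+ m.+1)))//; last first.
    by rewrite lerDl mulr_ge0 ?powR_ge0.
  have -> : g `^ gamma = g `^ alpha * g `^ (gamma - alpha).
    by rewrite -powR_split// addrC subrK.
  have -> : d * (g `^ alpha * g `^ (gamma - alpha) * z ^+ m.+1) =
      g `^ alpha * ((d * g `^ (gamma - alpha) * z) * z ^+ m).
    by rewrite exprS; ring.
  by rewrite ler_wpM2l ?powR_ge0// ler_wpM2r// exprn_ge0// ltW.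
rewrite (@le_trans _ _ (d `^ (1 - q) * b `^ q))//; last first.
  by rewrite lerDr !mulr_ge0 ?powR_ge0 ?exprn_ge0 ?(ltW d0) ?(ltW z0).
set y := g `^ (gamma - alpha) in bd.
have y0 : 0 < y by exact: powR_gt0.
(* By [aE], the exponents [(gamma - alpha) * (q - 1)] and [alpha] agree. *)
have -> : g `^ alpha = y `^ (q - 1) by rewrite /y -powRrM aE.
have zm : z ^+ m <= z `^ (q - 1).
  rewrite -powR_mulrn ?(ltW z0)//; apply: ger_powR; first by rewrite z0.
  by move: qm; rewrite -natr1; lra.
have -> : b `^ q = b `^ (q - 1) * b.
  by rewrite -[X in _ * X](powRr1 (ltW b0)) -powR_split// subrK.
have bq : (d * y * z) `^ (q - 1) <= b `^ (q - 1).
  apply: ge0_ler_powR; rewrite ?nnegrE ?(ltW b0) ?(ltW bd)//; first by lra.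
  by rewrite !mulr_ge0// ltW.
have dE : d `^ (1 - q) * d `^ (q - 1) = 1.
  by rewrite -powR_split// addrA subrK subrr powRr0.
rewrite mulrCA mulrC !mulrA ler_wpM2r ?(ltW b0)//.
apply: (@le_trans _ _ (d `^ (1 - q) * (d * y * z) `^ (q - 1))); last first.
  by rewrite ler_wpM2l ?powR_ge0.
rewrite !powRM ?mulr_ge0 ?(ltW d0) ?(ltW y0) ?(ltW z0)//.
by rewrite !mulrA dE mul1r ler_wpM2l ?powR_ge0.
Qed.

(** A small [d] absorbs [Y] into [X] and bounds [W], which then has a limit [I]. As [Y <= I - W n],
    the limit in [n] removes [Y] and leaves [cH * I <= nu * d^(1 - q) * K] for every [d]; since
    [1 < q], large [d] forces [I = 0]. *)
Lemma energy_sequence_eq0 (W : nat -> R) (cH nu K q : R) :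
  0 < cH -> 0 < nu -> 0 <= K -> 1 < q ->
  (forall n, 0 <= W n) -> {homo W : m n / (m <= n)%N >-> m <= n} ->
  (forall n, (0 < n)%N -> exists X Y,
    [/\ W n <= X, Y <= X, Y <= W (3 * n)%N - W n &
     forall d, 0 < d -> cH * X <= nu * (d * Y + d `^ (1 - q) * K)]) ->
  forall n, W n = 0.
Proof.
move=> cH0 nu0 K0 q1 W0 ndW H.
(* Chosen so that [nu * d0 * Y = cH * Y / 2], at most half of [cH * X]. *)
pose d0 := cH / (2 * nu).
have d00 : 0 < d0 by rewrite divr_gt0// mulr_gt0.
pose M := 2 * nu * (d0 `^ (1 - q) * K) / cH.
have WM n : W n <= M.
  apply: (@le_trans _ _ (W n.+1)); first exact: ndW.
  have [X [Y [WX YX _ /(_ _ d00)]]] := H n.+1 isT.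
  set C := d0 `^ (1 - q) * K => HC.
  rewrite (le_trans WX)// /M -/C ler_pdivlMr//.
  have : nu * (d0 * Y) <= cH * X / 2.
    have -> : nu * (d0 * Y) = cH * Y / 2 by rewrite /d0; field; rewrite gt_eqF.
    by rewrite ler_pM2r// ler_pM2l.
  by move: HC; rewrite mulrDr; lra.
have cvgW : cvgn W by apply: nondecreasing_is_cvgn => //; exists M => _ [n _ <-].
set I := limn W.
have WI n : W n <= I by exact: nondecreasing_cvgn_le.
have IK d : 0 < d -> cH * I <= nu * (d `^ (1 - q) * K).
  move=> dp; have step n : (cH + nu * d) * W n.+1 <=
      nu * (d * I) + nu * (d `^ (1 - q) * K).
    have [X [Y [WX _ YW /(_ _ dp) HX]]] := H n.+1 isT.
    have YI : Y <= I - W n.+1 by rewrite (le_trans YW)// lerD2r.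
    have : nu * (d * Y) <= nu * (d * (I - W n.+1)) by rewrite !ler_pM2l.
    have : cH * W n.+1 <= cH * X by rewrite ler_pM2l.
    by move: HX; rewrite mulrDr; nra.
  have : (cH + nu * d) * I <= nu * (d * I) + nu * (d `^ (1 - q) * K).
    rewrite -ler_pdivlMl ?addr_gt0 ?mulr_gt0//.
    (* The estimate holds from index 1 on; [W n <= W n.+1] carries it to every [n]. *)
    apply: limr_le => //; apply: nearW => n; apply: (le_trans (ndW _ _ (leqnSn n))).
    by rewrite ler_pdivlMl ?addr_gt0 ?mulr_gt0.
  by rewrite mulrDl -mulrA; lra.
have I0 : I <= 0.
  rewrite leNgt; apply/negP => Ip.
  (* With [d = e^(1 / (1 - q))] one has [d^(1 - q) = e], and [e] makes the bound at most
     [cH * I / 2]. [K + 1] guards against [K = 0]. *)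
  pose e := cH * I / (2 * (nu * (K + 1))).
  have K1 : 0 < nu * (K + 1) by rewrite mulr_gt0// ltr_wpDl.
  have e0 : 0 < e by apply: divr_gt0; apply: mulr_gt0.
  have := IK (e `^ (1 - q)^-1) (powR_gt0 _ e0).
  rewrite -powRrM mulVf ?powRr1 ?(ltW e0)//; last by lra.
  have : nu * (e * K) <= nu * (e * (K + 1)).
    by rewrite !ler_pM2l// lerDl.
  have -> : nu * (e * (K + 1)) = cH * I / 2.
    by rewrite /e; field; rewrite !gt_eqF// ltr_wpDl.
  have := mulr_gt0 cH0 Ip; lra.
by move=> n; apply/eqP; rewrite eq_le W0 andbT (le_trans (WI n)).
Qed.

End real_inequalities.

(** * The cutoff *)

Section cutoff.
Variables (R : realType) (N : nat).
Local Notation V := 'rV[R]_N.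
Local Notation T := (lebesgue_type R N).
Variables (r : R) (m : nat).
Hypothesis r0 : 0 < r.

(** For slope parameter [1 / r] the layers have width [2 * r]: [zeta] rises on [[-3r, -r]], equals 1
    on [[-r, r]] and falls on [[r, 3r]]. *)
Let zeta := bump r^-1 (- (3 * r)) r.
Let dzeta := dbump r^-1 (- (3 * r)) r.

(* The power of [precutoff] is needed to bound the gradient of the cutoff by
   [precutoff ^+ m], as required by [young_cutoff]. *)
Definition precutoff : V -> R := tensor (fun=> zeta).
Definition cutoff : V -> R := tensor (fun _ t => zeta t ^+ m.+1).

Let rV0 : 0 < r^-1. Proof. by rewrite invr_gt0. Qed.
Let r3 : - (3 * r) <= r.
Proof. by have := r0; lra. Qed.

Let zeta_itv t : 0 <= zeta t <= 1. Proof. exact: (bump_itv t rV0 r3). Qed.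

Let zeta_out t : 3 * r < `|t| -> zeta t = 0.
Proof.
rewrite /zeta lter_normr => /orP[rt|rt].
  by rewrite (bump_right rV0 r3) ?invrK//; lra.
by rewrite (bump_left rV0 r3)//; lra.
Qed.

Let zeta_in t : `|t| <= r -> zeta t = 1.
Proof.
rewrite ler_norml => /andP[t1 t2].
by rewrite /zeta (bump_mid rV0) ?invrK//; lra.
Qed.

Let dzeta_in t : `|t| <= r -> dzeta t = 0.
Proof.
rewrite ler_norml => /andP[t1 t2].
by rewrite /dzeta (dbump_mid rV0) ?invrK//; lra.
Qed.

Let is_derive_zetaX t :
  is_derive t (1 : R) (fun t => zeta t ^+ m.+1)
    (m.+1%:R * zeta t ^+ m * dzeta t).
Proof.
have D : is_derive t (1 : R) zeta (dzeta t) by exact: is_derive_bump.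
have -> : (fun t => zeta t ^+ m.+1) = zeta ^+ m.+1.
  by apply/funext => s; rewrite fctE.
by apply: is_derive_eq; rewrite /GRing.scale/= mulr_natl.
Qed.

Let continuous_zeta : continuous zeta.
Proof.
move=> t; apply: differentiable_continuous; apply/derivable1_diffP.
by have [] := is_derive_bump r^-1 (- (3 * r)) r t.
Qed.

Let continuous_zetaX k : continuous (fun t => zeta t ^+ k).
Proof.
move=> t; apply: (@continuous_comp _ _ _ zeta (fun x : R => x ^+ k)).
  exact: continuous_zeta.
exact: exprn_continuous.
Qed.

Let continuous_dzetaX :
  continuous (fun t => m.+1%:R * zeta t ^+ m * dzeta t).
Proof.
move=> t; apply: cvgM; last exact: continuous_dbump.
by apply: cvgM; [exact: cvg_cst|exact: continuous_zetaX].
Qed.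

Lemma cutoff_C1_0 : C1_0 cutoff.
Proof.
apply: (@tensor_C1_0 _ _ _ (fun _ t => m.+1%:R * zeta t ^+ m * dzeta t) (3 * r)).
- by move=> _ t; exact: is_derive_zetaX.
- by move=> _; exact: continuous_dzetaX.
- by move=> _ t rt; rewrite zeta_out// expr0n.
Qed.

Lemma measurable_cutoff : measurable_fun [set: T] cutoff.
Proof. by apply: measurable_tensor => _; exact: continuous_zetaX. Qed.

Lemma partial_cutoffE i : partial i cutoff =
  tensor (update (fun _ t => zeta t ^+ m.+1) i
    (fun t => m.+1%:R * zeta t ^+ m * dzeta t)).
Proof. by apply: partial_tensor => t; exact: is_derive_zetaX. Qed.

Lemma measurable_partial_cutoff i : measurable_fun [set: T] (partial i cutoff).
Proof.
rewrite partial_cutoffE; apply: measurable_tensor => j.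
by rewrite /update; case: ifP => _;
  [exact: continuous_dzetaX|exact: continuous_zetaX].
Qed.

Lemma precutoff_itv x : 0 <= precutoff x <= 1.
Proof.
apply/andP; split.
  by apply: prodr_ge0 => i _; have /andP[] := zeta_itv (x ord0 i).
by apply: prodr_ile1 => i _; exact: zeta_itv.
Qed.

Lemma cutoffE x : cutoff x = precutoff x ^+ m.+1.
Proof. by rewrite /cutoff /precutoff /tensor -prodrXl. Qed.

Lemma cutoff_itv x : 0 <= cutoff x <= 1.
Proof.
have /andP[z0 z1] := precutoff_itv x.
by rewrite cutoffE exprn_ge0// exprn_ile1.
Qed.

Lemma cutoff_in x : cube r x -> cutoff x = 1.
Proof.
by move=> xr; rewrite /cutoff /tensor big1// => i _; rewrite zeta_in ?expr1n.
Qed.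

Lemma cutoff_out x : ~ cube (3 * r) x -> cutoff x = 0.
Proof.
by apply: tensor_eq0 => _ t rt; rewrite zeta_out// expr0n.
Qed.

Lemma partial_cutoff_in i x : cube r x -> partial i cutoff x = 0.
Proof.
by move=> xr; rewrite partial_cutoffE tensor_update dzeta_in// mulr0 mul0r.
Qed.

Lemma partial_cutoff_out i x : ~ cube (3 * r) x -> partial i cutoff x = 0.
Proof.
rewrite partial_cutoffE; apply: tensor_eq0 => j t rt; rewrite /update.
case: ifP => _; last by rewrite zeta_out// expr0n.
rewrite /dzeta /dbump; move: rt; rewrite lter_normr => /orP[rt|rt].
  rewrite !dstep_ge2 ?subrr ?mulr0//.
    by rewrite ler_pdivlMl//; have := r0; lra.
  by rewrite ler_pdivlMl//; have := r0; lra.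
rewrite !dstep_le0 ?subrr ?mulr0// pmulr_rle0//; have := r0; lra.
Qed.

(** The differentiated factor gives [(m + 1) * zeta^m * dzeta] with [|dzeta| <= 1 / r]. Each other
    factor gives up one power of [zeta <= 1], and the remaining [m]-th powers assemble into
    [precutoff ^+ m]. *)
Lemma normr_partial_cutoff i x :
  `|partial i cutoff x| <= m.+1%:R / r * precutoff x ^+ m.
Proof.
rewrite partial_cutoffE tensor_update normrM [X in X * _]normrM.
rewrite [X in X * _ * _]normrM normr_nat.
have zn t : `|zeta t| = zeta t by have /andP[? ?] := zeta_itv t; rewrite ger0_norm.
have z0 t : 0 <= zeta t by have /andP[] := zeta_itv t.
have z1 t : zeta t <= 1 by have /andP[] := zeta_itv t.
rewrite [X in _ * X * _ * _]normrX zn normr_prod.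
have -> : precutoff x ^+ m =
    zeta (x ord0 i) ^+ m * \prod_(j < N | j != i) zeta (x ord0 j) ^+ m.
  by rewrite /precutoff /tensor -prodrXl (bigD1 i).
rewrite [leRHS]mulrA; apply: ler_pM => //.
- by rewrite !mulr_ge0// exprn_ge0.
- by apply: prodr_ge0 => j _.
- rewrite mulrAC ler_wpM2r ?exprn_ge0// ler_wpM2l//.
  exact: normr_dbump.
- apply: ler_prod => j _; rewrite normr_ge0/= normrX zn exprSr.
  by rewrite ler_piMr// exprn_ge0.
Qed.

End cutoff.

(** * The growth condition along a solution *)

Section euclidean_norm.
Variables (R : realType) (N : nat).
Local Notation V := 'rV[R]_N.
Implicit Types v w : V.

Lemma dotp_ge0 v : 0 <= dotp v v.
Proof. by apply: sumr_ge0 => i _; rewrite -expr2 sqr_ge0. Qed.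

Lemma enorm_ge0 v : 0 <= enorm v.
Proof. exact: sqrtr_ge0. Qed.

Lemma ler_coord_enorm v i : `|v ord0 i| <= enorm v.
Proof.
rewrite -sqrtr_sqr ler_sqrt ?dotp_ge0// /dotp (bigD1 i)//= -expr2 lerDl.
by apply: sumr_ge0 => j _; rewrite -expr2 sqr_ge0.
Qed.

Lemma enorm_eq0 v : enorm v = 0 -> v = 0.
Proof.
move=> v0; apply/rowP => i; rewrite mxE; apply/eqP.
by rewrite -normr_le0 -v0 ler_coord_enorm.
Qed.

(** The sum of absolute values of [w] is used because the partial derivatives of the cutoff are
    bounded one by one. *)
Lemma normr_dotp v w : `|dotp v w| <= enorm v * \sum_i `|w ord0 i|.
Proof.
rewrite mulr_sumr (le_trans (ler_norm_sum _ _ _))//.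
by apply: ler_sum => i _; rewrite normrM ler_wpM2r// ler_coord_enorm.
Qed.

Lemma continuous_enorm : continuous (@enorm R N).
Proof.
move=> v; apply: (@continuous_comp _ _ _ (fun v => dotp v v) Num.sqrt).
  apply: continuous_big; first exact: add_continuous.
  move=> i _ w; have c := @coord_continuous R 1 N ord0 i w.
  exact: (continuousM c c).
exact: sqrt_continuous.
Qed.

End euclidean_norm.

(** * The growth condition outside a single null set *)

Section caratheodory.
Variables (R : realType) (N : nat).
Local Notation V := 'rV[R]_N.
Local Notation mu := (@lebesgue_Rn R N).

Lemma rational_dense (s : R) (xi : V) (U : set (R * V)) : nbhs (s, xi) U ->
  exists q : rat * 'rV[rat]_N, U (ratr q.1, map_mx ratr q.2).
Proof.
move=> /nbhs_ballP[e /= e0 eU].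
have ap (t : R) : exists q : rat, `|t - ratr q| < e.
  have te : t - e < t + e by rewrite ltrD2l gt0_cp.
  have [q] := rat_in_itvoo te.
  rewrite in_itv/= => /andP[q1 q2]; exists q.
  by rewrite ltr_norml; apply/andP; split; lra.
have [f fP] := choice ap.
exists (f s, \row_i f (xi ord0 i)); apply: eU; split => /=; first exact: fP.
by split => // i j; rewrite !mxE (ord1 i); exact: fP.
Qed.

(** In the hypothesis the null set depends on [(s, xi)], so [u x] and [G x] cannot be substituted.
    The union of the null sets of the rational pairs is still null, and off it continuity extends
    the bound to all pairs. *)
Lemma caratheodory_growth (A : V -> R -> V -> V) (nu alpha : R) :
  0 < nu -> 0 < alpha -> caratheodory_fun A ->
  (forall s xi, {ae mu, forall x,
    enorm (A x s xi) <= nu * enorm xi `^ alpha}) ->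
  {ae mu, forall x, forall s xi, enorm (A x s xi) <= nu * enorm xi `^ alpha}.
Proof.
move=> nu0 al0 [_ cA] bA.
pose P n x := if @unpickle (rat * 'rV[rat]_N)%type n is Some q then
  enorm (A x (ratr q.1) (map_mx ratr q.2)) <=
    nu * enorm (map_mx ratr q.2 : V) `^ alpha else true.
have /ae_foralln aeP n : {ae mu, forall x, P n x}.
  rewrite /P; case: unpickle => [q|]; first exact: bA.
  exact: aeW.
have := negligibleU cA aeP.
rewrite -setCI; apply: negligibleS => x /=; apply: contra_not => -[cAx Px] s xi.
rewrite leNgt; apply/negP => lt_A.
set c := enorm (A x s xi) in lt_A.
(* Passing through [eta] avoids the continuity of [t `^ alpha] at 0, which is
   false from the left ([t `^ alpha = 1] for [t < 0]). *)
have [eta /andP[e1 e2]] : exists eta, enorm xi < eta < (c / nu) `^ alpha^-1.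
  suff H : enorm xi < (c / nu) `^ alpha^-1.
    by exists ((enorm xi + (c / nu) `^ alpha^-1) / 2); rewrite !(midf_lt H).
  rewrite -[ltLHS]powRr1 ?enorm_ge0// -(mulfV (lt0r_neq0 al0)) powRrM.
  apply: gt0_ltr_powR; rewrite ?nnegrE ?invr_gt0 ?powR_ge0//.
    by rewrite divr_ge0 ?enorm_ge0// ltW.
  by rewrite ltr_pdivlMr// mulrC.
have eta0 : 0 <= eta by rewrite ltW// (le_lt_trans (enorm_ge0 _) e1).
have ltc : nu * eta `^ alpha < c.
  rewrite mulrC -ltr_pdivlMr//.
  have -> : c / nu = ((c / nu) `^ alpha^-1) `^ alpha.
    by rewrite -powRrM mulVf ?(gt_eqF al0)// powRr1// divr_ge0 ?enorm_ge0// ltW.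
  by apply: gt0_ltr_powR => //; rewrite nnegrE ?powR_ge0.
(* On this neighbourhood the growth condition fails, yet it contains a rational pair. *)
have : nbhs (s, xi) [set z : R * V | enorm z.2 < eta /\
    nu * eta `^ alpha < enorm (A x z.1 z.2)].
  apply: filterI.
    have c2 : {for (s, xi), continuous (fun z : R * V => enorm z.2)}.
      apply: (@continuous_comp _ _ _ snd); first exact: cvg_snd.
      exact: continuous_enorm.
    exact: (cvgr_lt _ c2).
  have c2 : {for (s, xi), continuous (fun z : R * V => enorm (A x z.1 z.2))}.
    apply: (@continuous_comp _ _ _ (fun z => A x z.1 z.2)); first exact: cAx.
    exact: continuous_enorm.
  exact: (cvgr_gt _ c2).
move=> /rational_dense[q /= [q1 q2]].
have := Px (pickle q); rewrite /P pickleK => /(lt_le_trans q2).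
rewrite ltr_pM2l// ltNge => /negP; apply.
by apply: ge0_ler_powR; rewrite ?nnegrE ?enorm_ge0 ?(ltW al0) ?(ltW q1) ?eta0.
Qed.

End caratheodory.

(** * The energy estimate *)

Lemma le_normr_Rintegral_ae d (T : measurableType d) (R : realType)
    (mu : {measure set T -> \bar R}) (f g : T -> R) :
  measurable_fun [set: T] f -> (forall x, 0 <= g x) ->
  {ae mu, forall x, `|f x| <= g x} -> mu.-integrable [set: T] (EFin \o g) ->
  `|\int[mu]_x f x| <= \int[mu]_x g x.
Proof.
move=> mf g0 fg ig.
have mg : measurable_fun [set: T] g.
  by apply/measurable_EFinP; exact: measurable_int ig.
have Ig : (\int[mu]_x (g x)%:E \is a fin_num)%E by exact: integrable_fin_num.
have If : (`|\int[mu]_x (f x)%:E| <= \int[mu]_x (g x)%:E)%E.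
  apply: (le_trans (le_abse_integral _ _ _)) => //; first exact/measurable_EFinP.
  apply: ae_ge0_le_integral => //.
  - by do 2 apply: measurableT_comp => //; exact/measurable_EFinP.
  - by move=> x _; rewrite lee_fin.
  - exact/measurable_EFinP.
  - by apply: filterS fg => x fg _; rewrite /= lee_fin.
(* [fine] sends infinite values to 0, so finiteness must precede the comparison of real
   integrals. *)
have Ifin : (\int[mu]_x (f x)%:E \is a fin_num)%E.
  by rewrite fin_num_abs (le_lt_trans If)// ltey_eq Ig.
by rewrite /Rintegral -lee_fin -fine_abse// !fineK// abse_fin_num.
Qed.

Section measurability.
Variables (R : realType) (N : nat).
Local Notation V := 'rV[R]_N.
Local Notation T := (lebesgue_type R N).

Lemma measurable_dotp (v1 v2 : V -> V) :
  (forall i, measurable_fun [set: T] (fun x => v1 x ord0 i)) ->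
  (forall i, measurable_fun [set: T] (fun x => v2 x ord0 i)) ->
  measurable_fun [set: T] (fun x => dotp (v1 x) (v2 x)).
Proof.
by move=> m1 m2; apply: measurable_sum => i; exact: measurable_funM.
Qed.

Lemma measurable_enorm_powR (v : V -> V) (s : R) :
  (forall i, measurable_fun [set: T] (fun x => v x ord0 i)) ->
  measurable_fun [set: T] (fun x => enorm (v x) `^ s).
Proof.
move=> mv; apply: (measurableT_comp (measurable_powR s)).
apply: (measurableT_comp (continuous_measurable_fun (@sqrt_continuous R))).
exact: measurable_dotp.
Qed.

End measurability.

Section energy.
Variables (R : realType) (N : nat).
Local Notation V := 'rV[R]_N.
Local Notation mu := (@lebesgue_Rn R N).
Local Notation T := (lebesgue_type R N).
Variables (p gamma nu cH : R).
Hypotheses (p1 : 1 < p) (pgamma : p - 1 < gamma).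
Hypotheses (nu0 : 0 < nu) (cH0 : 0 < cH).
Let q := gamma / (gamma - (p - 1)).
Hypothesis qN : N%:R <= q.
Variables F G : V -> V.
Hypothesis mF : forall i, measurable_fun [set: T] (fun x => F x ord0 i).
Hypothesis mG : forall i, measurable_fun [set: T] (fun x => G x ord0 i).
Hypothesis FG : {ae mu, forall x, enorm (F x) <= nu * enorm (G x) `^ (p - 1)}.
Let w x := enorm (G x) `^ gamma.
Hypothesis wi : forall r, mu.-integrable (cube r) (EFin \o w).
(** The absolute value covers the inequality and the equation together, as the flux term enters them
    with opposite signs. *)
Hypothesis Fw : forall phi r, C1_0 phi -> measurable_fun [set: T] phi ->
  (forall x, 0 <= phi x <= 1) -> (forall x, ~ cube r x -> phi x = 0) ->
  cH * \int[mu]_x (w x * phi x) <= `|\int[mu]_x dotp (F x) (grad phi x)|.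

(** This choice gives [q < m + 1], as [young_cutoff] requires. *)
Let m := Num.truncn q.
Let W n := \int[mu]_(x in cube n%:R) w x.
(** The first factor comes from the sum of the [N] partial derivatives of the cutoff, the second
    from the volume [(6 * r)^N] of the outer cube; the powers of [r] are bounded by 1. *)
Let K := (N%:R * m.+1%:R) `^ q * 6 ^+ N.

Let gp0 : 0 < gamma - (p - 1). Proof. by rewrite subr_gt0. Qed.

Let q1 : 1 < q.
Proof. by rewrite /q ltr_pdivlMr// mul1r; have := p1; lra. Qed.

Let w_ge0 x : 0 <= w x. Proof. exact: powR_ge0. Qed.

Let mw : measurable_fun [set: T] w.
Proof. exact: measurable_enorm_powR. Qed.

(** [X] and [Y] are the integrals of [w] against the cutoff [phi] and against its restriction [psi]
    to the shell [D], outside which the gradient of [phi] vanishes. *)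
Lemma cutoff_energy n : (0 < n)%N -> exists X Y,
  [/\ W n <= X, Y <= X, Y <= W (3 * n)%N - W n &
   forall d, 0 < d -> cH * X <= nu * (d * Y + d `^ (1 - q) * K)].
Proof.
move=> n0; have w0 := w_ge0.
have r0 : 0 < n%:R :> R by rewrite ltr0n.
pose r : R := n%:R.
pose phi := @cutoff R N r m.
have mphi : measurable_fun [set: T] phi by exact: measurable_cutoff.
have phi01 x : 0 <= phi x <= 1 by exact: cutoff_itv.
have phi0 x : 0 <= phi x by have /andP[] := phi01 x.
have phi1 x : phi x <= 1 by have /andP[] := phi01 x.
pose D : set V := cube (3 * r) `\` cube r.
have mC3 : measurable (cube (3 * r) : set T) by exact: measurable_cube.
have mC1 : measurable (cube r : set T) by exact: measurable_cube.
have mD : measurable (D : set T) by exact: measurableD.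
have C13 : @cube R N r `<=` cube (3 * r).
  by move=> x xr i; rewrite (le_trans (xr i))//; lra.
pose psi x := phi x * \1_D x.
have mpsi : measurable_fun [set: T] psi by exact: measurable_funM.
have phi_out x : ~ cube (3 * r) x -> phi x = 0 by exact: cutoff_out.
have iphi : mu.-integrable [set: T] (EFin \o (fun x => w x * phi x)).
  apply: (integrable_mul_bounded (r := 3 * r) (M := 1)) => //.
  by move=> x; rewrite ger0_norm.
have ipsi : mu.-integrable [set: T] (EFin \o (fun x => w x * psi x)).
  apply: (integrable_mul_bounded (r := 3 * r) (M := 1)) => //.
    move=> x; rewrite /psi normrM ger0_norm// mulr_ile1//.
    by rewrite indicE; case: (_ \in _); rewrite ?normr1 ?normr0.
  by move=> x xr; rewrite /psi phi_out// mul0r.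
have i1 A : measurable (A : set T) -> A `<=` cube (3 * r) ->
    mu.-integrable [set: T] (EFin \o (fun x => w x * \1_A x)).
  move=> mA AC; apply: (integrable_mul_bounded (r := 3 * r) (M := 1)) => //.
    by move=> x; rewrite indicE; case: (_ \in _); rewrite ?normr1 ?normr0.
  by move=> x xr; rewrite indicE memNset// => /AC.
have WE k : \int[mu]_(x in cube k) w x = \int[mu]_x (w x * \1_(cube k) x).
  rewrite Rintegral_mkcond; apply: eq_Rintegral => x _.
  by rewrite patchE indicE; case: ifPn => _; rewrite ?mulr1 ?mulr0.
exists (\int[mu]_x (w x * phi x)), (\int[mu]_x (w x * psi x)); split.
- rewrite /W WE; apply: le_Rintegral => //; first exact: i1.
  move=> x _; rewrite ler_wpM2l// indicE.
  by case: (boolP (_ \in _)) => // /set_mem xr; rewrite /phi cutoff_in.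
- apply: le_Rintegral => // x _; rewrite ler_wpM2l// /psi ler_piMr//.
- have WD : W (3 * n)%N - W n = \int[mu]_x (w x * \1_D x).
    rewrite /W natrM !WE -RintegralB//; [|exact: i1..].
    apply: eq_Rintegral => x _; rewrite -mulrBr; congr (_ * _).
    rewrite !indicE /D in_setD; case: (boolP (x \in cube r)) => xr /=.
      by rewrite andbF mem_set ?subrr//; apply: C13; exact/set_mem.
    by rewrite andbT subr0.
  rewrite [leRHS]WD; apply: le_Rintegral => //; first by apply: i1 => // x [].
  by move=> x _; rewrite ler_wpM2l// /psi ler_piMl// indicE.
move=> d d0.
set cb := N%:R * (m.+1%:R / r).
have cb0 : 0 <= cb by rewrite /cb mulr_ge0// divr_ge0// ltW.
have ic3 : mu.-integrable [set: T] (EFin \o (\1_(cube (3 * r)) : V -> R)).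
  have := (integrable_mkcond _ mC3).1 (@integrable_cst_cube R N (3 * r) 1).
  apply: eq_integrable; first exact: measurableT.
  by move=> x _; rewrite patchE /= indicE; case: ifPn.
set a := nu * d; set b := nu * (d `^ (1 - q) * cb `^ q).
have ia : mu.-integrable [set: T] (EFin \o (fun x => a * (w x * psi x))).
  exact: (integrableZl measurableT a ipsi).
have ib : mu.-integrable [set: T]
    (EFin \o (fun x => b * (\1_(cube (3 * r)) : V -> R) x)).
  exact: (integrableZl measurableT b ic3).
(* The pointwise bound from [young_cutoff]; the indicator makes its constant term integrable. *)
pose h x := a * (w x * psi x) + b * (\1_(cube (3 * r)) : V -> R) x.
have ih : mu.-integrable [set: T] (EFin \o h).
  exact: (integrableD measurableT ia ib).
have hE : \int[mu]_x h x = a * (\int[mu]_x (w x * psi x)) + b * (6 * r) ^+ N.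
  rewrite RintegralD// !RintegralZl//; congr (_ + _ * _).
  have -> : \int[mu]_x (\1_(cube (3 * r)) : V -> R) x =
      fine (mu (cube (3 * r) : set T)).
    by rewrite /Rintegral integral_indic// setIT.
  rewrite lebesgue_cube/=; last by rewrite mulr_ge0// ltW.
  by rewrite mulrA -natrM.
apply: (le_trans (Fw (cutoff_C1_0 _ _ r0) mphi phi01 phi_out)).
have psi0 x : 0 <= psi x by rewrite mulr_ge0.
have a0 : 0 <= a by rewrite mulr_ge0// ltW.
have b0 : 0 <= b by rewrite !mulr_ge0 ?powR_ge0 ?(ltW nu0).
have h0 x : 0 <= h x.
  apply: addr_ge0; first exact: mulr_ge0 a0 (mulr_ge0 (w0 x) (psi0 x)).
  by rewrite mulr_ge0// indicE.
have mdot : measurable_fun [set: T] (fun x => dotp (F x) (grad phi x)).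
  apply: measurable_dotp => [i|i]; first exact: mF.
  have -> : (fun x => grad phi x ord0 i) = partial i phi.
    by apply/funext => x; rewrite mxE.
  exact: measurable_partial_cutoff.
apply: (@le_trans _ _ (\int[mu]_x h x)).
  apply: (le_normr_Rintegral_ae mdot h0 _ ih).
  apply: lebesgue_ae_imp FG => x FGx.
  have dotp0 : (forall i, partial i phi x = 0) ->
      `|dotp (F x) (grad phi x)| <= h x.
    move=> d0'; rewrite /dotp big1 ?normr0// => i _.
    by rewrite mxE d0' mulr0.
  have [xr|xr] := pselect (cube r x).
    by apply: dotp0 => i; exact: partial_cutoff_in.
  have [x3|x3] := pselect (cube (3 * r) x); last first.
    by apply: dotp0 => i; exact: partial_cutoff_out.
  have xD : x \in D by rewrite inE.
  have psiE : psi x = precutoff r x ^+ m.+1.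
    by rewrite /psi indicE xD mulr1 /phi cutoffE.
  rewrite /h indicE mem_set// mulr1 psiE.
  apply: (le_trans (normr_dotp _ _)).
  apply: (@le_trans _ _ (nu * enorm (G x) `^ (p - 1) *
      (cb * precutoff r x ^+ m))).
    apply: ler_pM; rewrite ?enorm_ge0 ?sumr_ge0//.
    apply: (@le_trans _ _ (\sum_(i < N) (m.+1%:R / r * precutoff r x ^+ m))).
      by apply: ler_sum => i _; rewrite mxE; exact: normr_partial_cutoff.
    by rewrite sumr_const card_ord -[leLHS]mulr_natl /cb -[leRHS]mulrA.
  have -> : a * (w x * precutoff r x ^+ m.+1) + b =
      nu * (d * (w x * precutoff r x ^+ m.+1) + d `^ (1 - q) * cb `^ q).
    by rewrite /a /b; ring.
  rewrite -[leLHS]mulrA ler_pM2l//.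
  apply: young_cutoff; rewrite ?enorm_ge0 ?precutoff_itv// ?subr_gt0//.
  exact/ltW/truncnS_gt.
rewrite hE.
have -> : a * (\int[mu]_x (w x * psi x)) + b * (6 * r) ^+ N =
    nu * (d * (\int[mu]_x (w x * psi x)) +
          d `^ (1 - q) * (cb `^ q * (6 * r) ^+ N)).
  by rewrite /a /b; ring.
rewrite ler_pM2l// lerD2l ler_wpM2l ?powR_ge0//.
have r1 : 1 <= r by rewrite ler1n.
(* The critical exponent enters here: [N <= q] and [1 <= r] give [r^(N - q) <= 1]. *)
have rVq : r^-1 `^ q * r ^+ N <= 1.
  have -> : 1 = r^-1 `^ q * r `^ q :> R.
    by rewrite -powRM ?invr_ge0 ?(ltW r0)// mulVf ?gt_eqF// powR1.
  rewrite ler_wpM2l ?powR_ge0// -powR_mulrn ?(ltW r0)//.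
  exact: ler_powR.
rewrite /cb mulrA powRM ?invr_ge0 ?mulr_ge0 ?(ltW r0)//.
rewrite exprMn mulrACA /K ler_piMr// mulr_ge0 ?powR_ge0 ?exprn_ge0//.
Qed.

End energy.

(** * Vanishing of the gradient *)

Section vanishing.
Variables (R : realType) (N : nat).
Local Notation V := 'rV[R]_N.
Local Notation mu := (@lebesgue_Rn R N).
Local Notation T := (lebesgue_type R N).
Variables (p gamma nu cH : R).
Hypotheses (N1 : (1 < N)%N) (p1 : 1 < p) (pgamma : p - 1 < gamma).
Hypothesis gammaN : gamma <= N%:R * (p - 1) / (N%:R - 1).
Hypotheses (nu0 : 0 < nu) (cH0 : 0 < cH).

(** Once denominators are cleared, this and [gammaN] both read [gamma * (N - 1) <= N * (p - 1)]. *)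
Lemma critical_exponent : N%:R <= gamma / (gamma - (p - 1)).
Proof.
have gp0 : 0 < gamma - (p - 1) by rewrite subr_gt0.
have N10 : 0 < N%:R - 1 :> R by rewrite subr_gt0 ltr1n.
rewrite ler_pdivlMr//; move: gammaN; rewrite ler_pdivlMr//; lra.
Qed.

(** The energy of every cube is zero by [energy_sequence_eq0], so the nonnegative density [w]
    vanishes a.e. on each of countably many cubes covering the space. *)
Lemma energy_gradient0 (F G : V -> V) :
  (forall i, measurable_fun [set: T] (fun x => F x ord0 i)) ->
  (forall i, measurable_fun [set: T] (fun x => G x ord0 i)) ->
  {ae mu, forall x, enorm (F x) <= nu * enorm (G x) `^ (p - 1)} ->
  (forall r, mu.-integrable (cube r) (EFin \o (fun x => enorm (G x) `^ gamma))) ->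
  (forall phi r, C1_0 phi -> measurable_fun [set: T] phi ->
    (forall x, 0 <= phi x <= 1) -> (forall x, ~ cube r x -> phi x = 0) ->
    cH * \int[mu]_x (enorm (G x) `^ gamma * phi x) <=
    `|\int[mu]_x dotp (F x) (grad phi x)|) ->
  {ae mu, forall x, G x = 0}.
Proof.
move=> mF mG FG wi Fw.
pose w x := enorm (G x) `^ gamma.
have w0 x : 0 <= w x by exact: powR_ge0.
have energy := cutoff_energy p1 pgamma nu0 critical_exponent mF mG FG wi Fw.
have q1 : 1 < gamma / (gamma - (p - 1)).
  by apply: lt_le_trans critical_exponent; rewrite ltr1n.
pose W n := \int[mu]_(x in cube n%:R) w x.
have W0 n : W n = 0.
  apply: (energy_sequence_eq0 cH0 nu0 _ q1 _ _ energy).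
  - by rewrite mulr_ge0 ?powR_ge0 ?exprn_ge0.
  - by move=> k; apply: Rintegral_ge0 => x _; exact: w0.
  - move=> k l kl; apply: fine_le.
    + by apply: integrable_fin_num => //; exact: measurable_cube.
    + by apply: integrable_fin_num => //; exact: measurable_cube.
    + apply: ge0_subset_integral.
      * exact: measurable_cube.
      * exact: measurable_cube.
      * exact: (measurable_int mu (wi l%:R)).
      * by move=> x _; rewrite lee_fin; exact: w0.
      * by move=> x xk i; rewrite (le_trans (xk i))// ler_nat.
have aen n : ae_eq mu (cube n%:R) (EFin \o w) (cst 0%E).
  apply/(ae_eq_integral_abs mu (measurable_cube n%:R) (measurable_int mu (wi n%:R))).
  have : (\int[mu]_(x in cube n%:R) (w x)%:E = 0)%E.
    rewrite -[LHS]fineK; last first.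
      by apply: integrable_fin_num => //; exact: measurable_cube.
    by congr (_%:E); exact: W0.
  have -> : (\int[mu]_(x in cube n%:R) `|(EFin \o w) x| =
      \int[mu]_(x in cube n%:R) (w x)%:E)%E.
    by apply: eq_integral => x _; rewrite /= ger0_norm.
  exact.
apply: lebesgue_ae_imp (ae_foralln aen) => x H.
pose n := (Num.truncn (\sum_j `|x ord0 j|)).+1.
have xn : cube n%:R x.
  move=> j; apply/ltW; apply: le_lt_trans (truncnS_gt _).
  by rewrite (bigD1 j)//= lerDl sumr_ge0.
by apply/enorm_eq0/(@powR_eq0_eq0 _ _ gamma); case: (H n xn).
Qed.

End vanishing.

Theorem corollary1p3 (R : realType) (N : nat) (p gamma nu cH : R)
    (A : 'rV[R]_N -> R -> 'rV[R]_N -> 'rV[R]_N)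
    (B2 : 'rV[R]_N -> R -> 'rV[R]_N -> R) :
  (1 < N)%N ->
  1 < p -> p < N%:R ->
  p - 1 < gamma -> gamma <= N%:R * (p - 1) / (N%:R - 1) ->
  0 < nu -> 0 < cH ->
  caratheodory_fun A ->
  (forall s xi, {ae @lebesgue_Rn R N, forall x,
    enorm (A x s xi) <= nu * enorm xi `^ (p - 1)}) ->
  (forall x s xi, cH * enorm xi `^ gamma <= B2 x s xi) ->
  (forall u : 'rV[R]_N -> R, dist_supersolution p A B2 u -> ae_constant u) /\
  (forall u : 'rV[R]_N -> R, dist_solution p gamma cH A u -> ae_constant u).
Proof.
move=> N1 p1 _ pgamma gammaN nu0 cH0 cA bA bB.
have p10 : 0 < p - 1 by rewrite subr_gt0.
have growth := caratheodory_growth nu0 p10 cA bA.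
have FGu u (G : 'rV[R]_N -> 'rV[R]_N) : {ae @lebesgue_Rn R N, forall x,
    enorm (A x (u x) (G x)) <= nu * enorm (G x) `^ (p - 1)}.
  by apply: lebesgue_ae_imp growth => x; exact.
have mw (G : 'rV[R]_N -> 'rV[R]_N) : Lloc_vec p G ->
    measurable_fun [set: lebesgue_type R N] (fun x => enorm (G x) `^ gamma).
  by move=> GL; apply: measurable_enorm_powR => i; exact: (GL i).1.
have bounded_int f (phi : 'rV[R]_N -> R) r :
    measurable_fun [set: lebesgue_type R N] f ->
    (@lebesgue_Rn R N).-integrable (cube r) (EFin \o f) ->
    measurable_fun [set: lebesgue_type R N] phi ->
    (forall x, 0 <= phi x <= 1) -> (forall x, ~ cube r x -> phi x = 0) ->
    (@lebesgue_Rn R N).-integrable [set: lebesgue_type R N]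
      (EFin \o (fun x => f x * phi x)).
  move=> mf fi mphi phi01 phi_out.
  apply: (integrable_mul_bounded (M := 1) fi mf mphi _ phi_out) => x.
  by have /andP[phi0 phi1] := phi01 x; rewrite ger0_norm.
split=> u [G [[uL GL uG] AL BL ineq]];
    apply: (weak_gradient0_ae_constant (ltW p1) (And3 uL GL uG)).
  (* For the inequality, local integrability of [|grad u|^gamma] follows from that of [B2], which
     dominates [cH * |grad u|^gamma]. *)
  have wi r : (@lebesgue_Rn R N).-integrable (cube r)
      (EFin \o (fun x => enorm (G x) `^ gamma)).
    have iB := Lloc_integrable r (lexx 1) BL.
    apply: (le_integrable (measurable_cube r) _ _
      (integrableZl (measurable_cube r) cH^-1 iB)).
      by apply/measurable_EFinP/measurable_funTS; exact: mw GL.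
    move=> x _; rewrite /= lee_fin ger0_norm ?powR_ge0//.
    by rewrite (le_trans _ (ler_norm _))// ler_pdivlMl.
  apply: (energy_gradient0 N1 p1 pgamma gammaN nu0 cH0
    (fun i => (AL i).1) (fun i => (GL i).1) (FGu u G) wi).
  move=> phi r C1 mphi phi01 phi_out.
  have phi0 x : 0 <= phi x by have /andP[] := phi01 x.
  (* The weak inequality places the integral of [B2 * phi] between the two sides, which leaves a
     pointwise comparison. *)
  apply: (le_trans _ (ler_norm _)); apply: (le_trans _ (ineq _ C1 phi0)).
  have iw := bounded_int _ _ _ (mw _ GL) (wi r) mphi phi01 phi_out.
  rewrite -RintegralZl//; apply: le_Rintegral => //.
  - exact: (integrableZl measurableT cH iw).
  - exact: (bounded_int _ _ _ BL.1 (Lloc_integrable r (lexx 1) BL)).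
  - by move=> x _; rewrite mulrA ler_wpM2r.
(* For the equation this integrability is part of the definition, and the sign of the lower-order
   term disappears in the absolute value. *)
have wi r := Lloc_integrable r (lexx 1) BL.
apply: (energy_gradient0 N1 p1 pgamma gammaN nu0 cH0
  (fun i => (AL i).1) (fun i => (GL i).1) (FGu u G) wi).
move=> phi r C1 mphi phi01 phi_out.
have iw := bounded_int _ _ _ (mw _ GL) (wi r) mphi phi01 phi_out.
rewrite ineq// normrN (le_trans _ (ler_norm _))// -RintegralZl//.
by under [leRHS]eq_Rintegral do rewrite -mulrA.
Qed.
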